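(* Let $a,b,c\in\mathbb R$, $c\neq0$, let $(u_1,u_2,p_{u_1},p_{u_2})$ be canonical coordinates on $T^*\mathbb R^2$, and let $\lambda_1,\lambda_2$ and the compatible Poisson brackets $\{\cdot,\cdot\}$, $\{\cdot,\cdot\}'$ be as in the context. Put $$\hat H_1=\frac{\bigl(bu_1u_2+c(3u_1+u_2)\bigr)u_1^4p_{u_1}^2}{c(u_1-u_2)}+\frac{\bigl(bu_1u_2+c(u_1+3u_2)\bigr)u_2^4p_{u_2}^2}{c(u_2-u_1)}-\frac{(bu_1+c)(au_1^2+bu_1+c)}{cu_1^4}$$ $$-\frac{(bu_2+c)(au_2^2+bu_2+c)}{cu_2^4}-\frac{4ac+b^2}{cu_1u_2}-\frac{5b(u_1+u_2)}{u_1^2u_2^2}-\frac{4c(u_1^2+u_1u_2+u_2^2)}{u_1^3u_2^3}$$ and $\hat H_2=F\,G^2$, where $$F=cu_1^4u_2^4(u_1^2p_{u_1}-u_2^2p_{u_2})^2+\frac{(u_1-u_2)^2}{4}\Bigl((3u_1^2+2u_1u_2+3u_2^2)c^2+2u_1u_2\bigl(2au_1u_2+b(u_1+u_2)\bigr)c-b^2u_1^2u_2^2\Bigr),$$ $$G=\frac{u_1^4p_{u_1}^2-u_2^4p_{u_2}^2}{c(u_1-u_2)^2}-\frac{a(u_1+u_2)}{cu_1^2u_2^2(u_1-u_2)}-\frac{b(u_1^2+u_1u_2+u_2^2)}{cu_1^3u_2^3(u_1-u_2)}-\frac{(u_1+u_2)(u_1^2+u_2^2)}{u_1^4u_2^4(u_1-u_2)}.$$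 Then $\hat H_1=2(\lambda_1+\lambda_2)$ and $\hat H_2=-(\lambda_1-\lambda_2)^2$. Consequently $\hat H_1$ is an integrable Hamiltonian whose second integral $\hat H_2$ is a polynomial of sixth order in the momenta, $\{\hat H_1,\hat H_2\}=\{\hat H_1,\hat H_2\}'=0$, and the Hamiltonian vector field of $\hat H_1$ is bi-Hamiltonian: if $\Pi,\Pi'$ denote the Poisson bivectors of $\{\cdot,\cdot\},\{\cdot,\cdot\}'$, then $$\Pi\, d(\lambda_1+\lambda_2)=\Pi'\, d\left(\frac{\lambda_1^2+\lambda_2^2}{2}\right).$$
   Context: The variables $\hat u_1,\hat u_2$ are the two solutions $x$ of $$\left(h_1-\left(\frac{u_1^3p_{u_1}-u_2^3p_{u_2}}{u_1-u_2}\right)^2\right)x^2-\frac{bu_1u_2+c(u_1+u_2)}{u_1^2u_2^2}\,x-\frac{c}{u_1u_2}=0,$$ $$h_1=\frac{u_1^5p_{u_1}^2}{u_1-u_2}+\frac{u_2^5p_{u_2}^2}{u_2-u_1}-\frac{a}{u_1u_2}-\frac{b(u_1+u_2)}{u_1^2u_2^2}-\frac{c(u_1^2+u_1u_2+u_2^2)}{u_1^3u_2^3},$$ with momenta $$\hat p_{u_i}=-\hat u_i^{-4}\,Q(\hat u_i),\qquad Q(x)=x\left(\frac{(x-u_2)u_1^3p_{u_1}}{u_1-u_2}+\frac{(x-u_1)u_2^3p_{u_2}}{u_2-u_1}\right),$$ and $$\lambda_i=\frac12\left(\hat u_i^4\hat p_{u_i}^2+\frac{a}{\hat u_i^2}+\frac{b}{\hat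 u_i^3}+\frac{c}{\hat u_i^4}\right),\qquad i=1,2.$$ The bracket $\{\cdot,\cdot\}$ is the canonical one, $\{u_i,p_{u_j}\}=\delta_{ij}$, $\{u_1,u_2\}=\{p_{u_1},p_{u_2}\}=0$ (in which $(\hat u_i,\hat p_{u_i})$ are also canonical). The bracket $\{\cdot,\cdot\}'$ is defined by $\{\hat u_i,\hat p_{u_j}\}'=\lambda_i^{-1}\delta_{ij}$, $\{\hat u_1,\hat u_2\}'=\{\hat p_{u_1},\hat p_{u_2}\}'=0$. Everything is understood locally at generic points, where all expressions are defined, with smooth local branches of $\hat u_i$ (complex values allowed). ''Integrable'' means that $\hat H_1,\hat H_2$ are functionally independent and in involution. *)

(* Defs.v *)
From HB Require Import structures.
From mathcomp Require Import all_boot all_order all_algebra.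
From mathcomp Require Import complex.
From mathcomp Require Import all_classical all_reals all_analysis.
From mathcomp Require mpoly.

Set Implicit Arguments.
Unset Strict Implicit.
Unset Printing Implicit Defensive.

Import Order.TTheory GRing.Theory Num.Theory.
Import numFieldNormedType.Exports.

Local Open Scope classical_set_scope.
Local Open Scope complex_scope.
Local Open Scope ring_scope.

Definition h1 (K : fieldType) (a b c u1 u2 p1 p2 : K) : K :=
  u1 ^+ 5 * p1 ^+ 2 / (u1 - u2) + u2 ^+ 5 * p2 ^+ 2 / (u2 - u1)
  - a / (u1 * u2) - b * (u1 + u2) / (u1 ^+ 2 * u2 ^+ 2)
  - c * (u1 ^+ 2 + u1 * u2 + u2 ^+ 2) / (u1 ^+ 3 * u2 ^+ 3).

Definition quad (K : fieldType) (a b c u1 u2 p1 p2 z : K) : K :=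
  (h1 a b c u1 u2 p1 p2
     - ((u1 ^+ 3 * p1 - u2 ^+ 3 * p2) / (u1 - u2)) ^+ 2) * z ^+ 2
  - (b * u1 * u2 + c * (u1 + u2)) / (u1 ^+ 2 * u2 ^+ 2) * z
  - c / (u1 * u2).

Definition Qpol (K : fieldType) (u1 u2 p1 p2 z : K) : K :=
  z * ((z - u2) * u1 ^+ 3 * p1 / (u1 - u2)
       + (z - u1) * u2 ^+ 3 * p2 / (u2 - u1)).

Definition lambda (K : fieldType) (a b c q p : K) : K :=
  (q ^+ 4 * p ^+ 2 + a / q ^+ 2 + b / q ^+ 3 + c / q ^+ 4) / 2.

Definition H1 (K : fieldType) (a b c u1 u2 p1 p2 : K) : K :=
  (b * u1 * u2 + c * (3 * u1 + u2)) * u1 ^+ 4 * p1 ^+ 2 / (c * (u1 - u2))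
  + (b * u1 * u2 + c * (u1 + 3 * u2)) * u2 ^+ 4 * p2 ^+ 2 / (c * (u2 - u1))
  - (b * u1 + c) * (a * u1 ^+ 2 + b * u1 + c) / (c * u1 ^+ 4)
  - (b * u2 + c) * (a * u2 ^+ 2 + b * u2 + c) / (c * u2 ^+ 4)
  - (4 * a * c + b ^+ 2) / (c * u1 * u2)
  - 5 * b * (u1 + u2) / (u1 ^+ 2 * u2 ^+ 2)
  - 4 * c * (u1 ^+ 2 + u1 * u2 + u2 ^+ 2) / (u1 ^+ 3 * u2 ^+ 3).

Definition Ffac (K : fieldType) (a b c u1 u2 p1 p2 : K) : K :=
  c * u1 ^+ 4 * u2 ^+ 4 * (u1 ^+ 2 * p1 - u2 ^+ 2 * p2) ^+ 2
  + (u1 - u2) ^+ 2 / 4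
    * ((3 * u1 ^+ 2 + 2 * u1 * u2 + 3 * u2 ^+ 2) * c ^+ 2
       + 2 * u1 * u2 * (2 * a * u1 * u2 + b * (u1 + u2)) * c
       - b ^+ 2 * u1 ^+ 2 * u2 ^+ 2).

Definition Gfac (K : fieldType) (a b c u1 u2 p1 p2 : K) : K :=
  (u1 ^+ 4 * p1 ^+ 2 - u2 ^+ 4 * p2 ^+ 2) / (c * (u1 - u2) ^+ 2)
  - a * (u1 + u2) / (c * u1 ^+ 2 * u2 ^+ 2 * (u1 - u2))
  - b * (u1 ^+ 2 + u1 * u2 + u2 ^+ 2) / (c * u1 ^+ 3 * u2 ^+ 3 * (u1 - u2))
  - (u1 + u2) * (u1 ^+ 2 + u2 ^+ 2) / (u1 ^+ 4 * u2 ^+ 4 * (u1 - u2)).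

Definition H2 (K : fieldType) (a b c u1 u2 p1 p2 : K) : K :=
  Ffac a b c u1 u2 p1 p2 * Gfac a b c u1 u2 p1 p2 ^+ 2.

Definition total_degree (R : nzRingType) (n : nat) (q : mpoly.mpoly n R) : nat :=
  (\max_(m <- mpoly.msupp q) mpoly.mdeg m)%N.

(* A point of T^*R^2 is the real row vector (u_1, u_2, p_{u_1}, p_{u_2}).
   Functions on it take values in R[i]: the branches of \hat u_i may be
   non-real at real points. *)
Definition at_point (R : realType) (T : Type) (f : R -> R -> R -> R -> T)
    (x : 'rV[R]_4) : T :=
  f (x 0 0) (x 0 1) (x 0 2) (x 0 3).

Definition at_pointC (R : realType) (T : Type)
    (f : R[i] -> R[i] -> R[i] -> R[i] -> T) (x : 'rV[R]_4) : T :=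
  f (x 0 0)%:C (x 0 1)%:C (x 0 2)%:C (x 0 3)%:C.

(* R[i] carries no normed R-module structure in the library, so derivatives
   of R[i]-valued functions of real variables are taken componentwise. *)
Definition pd (R : realType) (i : 'I_4) (f : 'rV[R]_4 -> R[i])
    (x : 'rV[R]_4) : R[i] :=
  'D_(delta_mx 0 i) (fun y => complex.Re (f y)) x
  +i* 'D_(delta_mx 0 i) (fun y => complex.Im (f y)) x.

Definition differentiableC (R : realType) (f : 'rV[R]_4 -> R[i])
    (x : 'rV[R]_4) : Prop :=
  differentiable (fun y => complex.Re (f y)) x
  /\ differentiable (fun y => complex.Im (f y)) x.

(* C^oo on U: all iterated partial derivatives are differentiable on U. *)
Definition smooth_on (R : realType) (U : set 'rV[R]_4)
    (f : 'rV[R]_4 -> R[i]) : Prop :=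
  forall (s : seq 'I_4) x, U x -> differentiableC (foldr (@pd R) f s) x.

Definition grad (R : realType) (f : 'rV[R]_4 -> R[i]) (x : 'rV[R]_4) :
    'rV[R[i]]_4 :=
  \row_i pd i f x.

(* A bivector field P is given by its matrix of components; its bracket is
   {f, g} = df P dg, and P df is the vector field below. *)
Definition bracket (R : realType) (P : 'rV[R]_4 -> 'M[R[i]]_4)
    (f g : 'rV[R]_4 -> R[i]) (x : 'rV[R]_4) : R[i] :=
  (grad f x *m P x *m (grad g x)^T) 0 0.

Definition ham_field (R : realType) (P : 'rV[R]_4 -> 'M[R[i]]_4)
    (f : 'rV[R]_4 -> R[i]) (x : 'rV[R]_4) : 'cV[R[i]]_4 :=
  P x *m (grad f x)^T.

Definition poisson_on (R : realType) (U : set 'rV[R]_4)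
    (P : 'rV[R]_4 -> 'M[R[i]]_4) : Prop :=
  [/\ forall i j, smooth_on U (fun x => P x i j),
      forall x, U x -> (P x)^T = - P x
    & forall x, U x -> forall i j k : 'I_4,
        \sum_l (P x i l * pd l (fun y => P y j k) x
                + P x j l * pd l (fun y => P y k i) x
                + P x k l * pd l (fun y => P y i j) x) = 0].

(* With (s, t) = (1, 0) and (0, 1) this says that P and P' are themselves
   Poisson. *)
Definition compatible_on (R : realType) (U : set 'rV[R]_4)
    (P P' : 'rV[R]_4 -> 'M[R[i]]_4) : Prop :=
  forall s t : R[i], poisson_on U (fun x => s *: P x + t *: P' x).

Definition Pi_can (R : realType) (x : 'rV[R]_4) : 'M[R[i]]_4 :=
  (block_mx 0 1%:M (- 1%:M) 0 : 'M[R[i]]_(2 + 2)).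

Definition Hhat1 (R : realType) (a b c : R) (x : 'rV[R]_4) : R[i] :=
  (at_point (H1 a b c) x)%:C.

Definition Hhat2 (R : realType) (a b c : R) (x : 'rV[R]_4) : R[i] :=
  (at_point (H2 a b c) x)%:C.

Definition regular_points (R : realType) : set 'rV[R]_4 :=
  [set x | [/\ x 0 0 != 0, x 0 1 != 0 & x 0 0 != x 0 1]].

(* Pointwise independence of the differentials cannot hold everywhere (it fails
   at critical points of f or g), hence the density. *)
Definition functionally_independent (R : realType) (U : set 'rV[R]_4)
    (f g : 'rV[R]_4 -> R[i]) : Prop :=
  U `<=` closure (U `&` [set x | row_free (col_mx (grad f x) (grad g x))]).

Definition integrable_on (R : realType) (U : set 'rV[R]_4)
    (f g : 'rV[R]_4 -> R[i]) : Prop :=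
  functionally_independent U f g
  /\ forall x, U x -> bracket (@Pi_can R) f g x = 0.

Definition phat (R : realType) (uh : 'I_2 -> 'rV[R]_4 -> R[i]) (i : 'I_2)
    (x : 'rV[R]_4) : R[i] :=
  - (uh i x) ^- 4 * at_pointC (@Qpol R[i]) x (uh i x).

Definition lam (R : realType) (a b c : R) (uh : 'I_2 -> 'rV[R]_4 -> R[i])
    (i : 'I_2) (x : 'rV[R]_4) : R[i] :=
  lambda a%:C b%:C c%:C (uh i x) (phat uh i x).

(* Smooth branches uh 0, uh 1 of the two roots over an open set U of generic
   points.  When c != 0 the quadratic has no zero root, so that phat and lam
   are defined, and having two distinct roots forces its leading coefficient
   to be nonzero. *)
Definition generic_branches (R : realType) (a b c : R) (U : set 'rV[R]_4)
    (uh : 'I_2 -> 'rV[R]_4 -> R[i]) : Prop :=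
  [/\ open U /\ U `<=` @regular_points R,
      forall i, smooth_on U (uh i),
      forall x, U x -> forall z : R[i],
        at_pointC (quad a%:C b%:C c%:C) x z = 0 <-> z = uh 0 x \/ z = uh 1 x,
      forall x, U x -> uh 0 x != uh 1 x
    & forall i x, U x -> lam a b c uh i x != 0].

(* On U the functions uh i, phat uh i are local coordinates (complex-valued),
   so these relations determine P' there. *)
Definition second_bivector (R : realType) (a b c : R) (U : set 'rV[R]_4)
    (uh : 'I_2 -> 'rV[R]_4 -> R[i]) (P' : 'rV[R]_4 -> 'M[R[i]]_4) : Prop :=
  forall x, U x ->
    [/\ (P' x)^T = - P' x,
        forall i j, bracket P' (uh i) (phat uh j) x
                    = (lam a b c uh i x)^-1 *+ (i == j),
        bracket P' (uh 0) (uh 1) x = 0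
      & bracket P' (phat uh 0) (phat uh 1) x = 0].

(* Main.v *)
(** In terms of [y = 1 / uhat], [e1 = 1/u1 + 1/u2], [e2 = 1/(u1 u2)] and the
    line [S z + T] with [Q(z) = z (S z + T)], the quadratic equation reads
    [c y^2 + (b + c e1) y + kappa = 0], where [kappa] is a polynomial in
    [e1, e2, T], and separation of variables gives
    [lambda_i = (h1 + h2 y_i) / 2] with [h1, h2] polynomials in [e1, e2, S, T].
    Vieta's formulas then yield both expressions of the Hamiltonians, and the
    very simple canonical brackets of [e1, e2, S, T] yield their involution and,
    by implicit differentiation of the roots, the canonicity of [(uhat, phat)].

    The matrix of differentials of [(uhat, phat)] therefore brings both
    bivectors to normal form, with blocks [1] and [1 / lambda_i].  The Jacobi
    identity of the pencil is transported from these coordinates; the second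
    derivatives that appear cancel because mixed partials commute.

    For independence, the Jacobian of [(H1, H2)] with respect to [(S, T)],
    restricted to a line parallel to one of the two momentum axes, is a
    polynomial of degree [6] whose leading coefficient does not vanish. *)

Require Import Defs.
From HB Require Import structures.
From mathcomp Require Import all_boot all_order all_algebra.
From mathcomp Require Import complex.
From mathcomp Require Import all_classical all_reals all_analysis.
From mathcomp Require mpoly.
From mathcomp Require Import ring.

Set Implicit Arguments.
Unset Strict Implicit.
Unset Printing Implicit Defensive.

Import Order.TTheory GRing.Theory Num.Theory.
Import numFieldNormedType.Exports.

Local Open Scope classical_set_scope.
Local Open Scope complex_scope.
Local Open Scope ring_scope.

(** * Calculus of complex-valued functions *)

(** The branches are known only through the quadratic they satisfy, and they may be non-real at real
    points, so [(uhat, phat)] is not a chart and no change of variables is available. Every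
    computation is therefore made on covectors at one point: a differential is recorded by its
    coefficients on the rows of a matrix of four gradients. The formula for [lambda_i] has a
    geometric source. On [w = -Q(z)], the separation equation written in [1 / z] is a quartic; it
    vanishes at [1/u1] and [1/u2], and the remaining quadratic factor is exactly the one defining
    the [y_i]. Working with [y] rather than [uhat] makes the known nonzero constant [c] the leading
    coefficient. In normal form the pencil has blocks [s + t / lambda_i], and [lambda_i] depends on
    the [i]-th conjugate pair alone. It thus behaves like a sum of two bivectors living in separate
    planes, where the Jacobi identity is automatic. *)

Lemma near_eq_differentiable (R : realType) (V : normedModType R)
    (f g : V -> R) (x : V) :
  {near x, f =1 g} -> differentiable f x -> differentiable g x.
Proof.
move=> fg df.
(* [g - f] vanishes near [x], so it has an expansion with zero differential and a remainder that is
   eventually zero. Differentiability of [g] then follows from [g = f + (g - f)]. *)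
have key : (g - f : V -> R) \o shift x
    = cst ((g - f : V -> R) x) + (\0 : {linear V -> R}) +o_ (0 : V) id.
  apply/eqaddoP => _/posnumP[e].
  have fgx : f x = g x by exact: (nbhs_singleton fg).
  have fg0 : \forall y \near (0 : V), f (y + x) = g (y + x).
    have := fg; rewrite (near_shift 0 x) => h.
    by apply: filterS h => y /=; rewrite subr0.
  apply: filterS fg0 => y /= fgy.
  rewrite !fctE /= fgy fgx !subrr addr0 subr0 normr0.
  by rewrite mulr_ge0.
have dgf : differentiable (g - f : V -> R) x.
  apply/diff_locallyP; rewrite (diff_unique _ key); last by move=> ?; exact: cvg_cst.
  by split; [move=> ?; exact: cvg_cst|].
have -> : g = f + (g - f) by apply/funext => y; rewrite !fctE addrC subrK.
exact: differentiableD.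
Qed.

Section Calculus.
Variable R : realType.
Local Notation C := R[i].
Local Notation Re := (@complex.Re R).
Local Notation Im := (@complex.Im R).
Implicit Types (f g : 'rV[R]_4 -> C) (x : 'rV[R]_4).

Lemma differentiableC_near f g x :
  {near x, f =1 g} -> differentiableC f x -> differentiableC g x.
Proof.
move=> fg [d1 d2]; split.
  by apply: near_eq_differentiable d1; apply: filterS fg => y ->.
by apply: near_eq_differentiable d2; apply: filterS fg => y ->.
Qed.

Lemma pd_near i f g x : {near x, f =1 g} -> pd i f x = pd i g x.
Proof.
move=> fg; rewrite /pd; congr (_ +i* _).
  by apply: near_eq_derive; apply: filterS fg => y ->.
by apply: near_eq_derive; apply: filterS fg => y ->.
Qed.

Lemma differentiableC_cst (k : C) x : differentiableC (fun=> k) x.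
Proof. by split; exact: differentiable_cst. Qed.

Lemma pd_cst i (k : C) x : pd i (fun=> k) x = 0.
Proof. by rewrite /pd !derive_cst. Qed.

Lemma differentiableC_coord i x : differentiableC (fun y => (y 0 i)%:C) x.
Proof. by split; [exact: differentiable_coord | exact: differentiable_cst]. Qed.

Lemma pd_coord i j x : pd i (fun y => (y 0 j)%:C) x = (i == j)%:R.
Proof.
rewrite /pd derive_cst /=.
have -> : 'D_(delta_mx 0 i) (fun y : 'rV[R]_4 => y 0 j) x = (i == j)%:R.
  have -> : (fun y : 'rV[R]_4 => y 0 j) = (fun y : 'rV[R]_4 => y 0 j) \o id by [].
  rewrite deriveE; last exact: differentiable_coord.
  (* A coordinate is its own differential, once packaged as a linear map; the transparent [@l] lets
     it be unfolded afterwards. *)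
  have @l : {linear 'rV[R]_4 -> R}.
    by exists (fun N : 'rV[R]_4 => N 0 j); do 2![eexists]; do ?[constructor];
      rewrite ?mxE// => ? *; rewrite ?mxE//; move=> ?; rewrite !mxE.
  have -> : (fun y : 'rV[R]_4 => y 0 j) \o id = l by [].
  rewrite diff_lin; last exact: coord_continuous.
  by rewrite /l /= mxE eqxx eq_sym.
by case: (i == j) => /=.
Qed.

Lemma differentiableC_add f g x :
  differentiableC f x -> differentiableC g x -> differentiableC (fun y => f y + g y) x.
Proof.
move=> [f1 f2] [g1 g2]; split.
  have -> : (fun y => Re (f y + g y)) = (fun y => Re (f y)) + (fun y => Re (g y)).
    by apply/funext => y; rewrite !fctE; case: (f y); case: (g y).
  exact: differentiableD.
have -> : (fun y => Im (f y + g y)) = (fun y => Im (f y)) + (fun y => Im (g y)).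
  by apply/funext => y; rewrite !fctE; case: (f y); case: (g y).
exact: differentiableD.
Qed.

Lemma pd_add i f g x : differentiableC f x -> differentiableC g x ->
  pd i (fun y => f y + g y) x = pd i f x + pd i g x.
Proof.
move=> [f1 f2] [g1 g2]; rewrite /pd.
have -> : (fun y => Re (f y + g y)) = (fun y => Re (f y)) + (fun y => Re (g y)).
  by apply/funext => y; rewrite !fctE; case: (f y); case: (g y).
have -> : (fun y => Im (f y + g y)) = (fun y => Im (f y)) + (fun y => Im (g y)).
  by apply/funext => y; rewrite !fctE; case: (f y); case: (g y).
by rewrite !deriveD //; exact: diff_derivable.
Qed.

Lemma ReM (z w : C) : Re (z * w) = Re z * Re w - Im z * Im w.
Proof. by case: z; case: w. Qed.

Lemma ImM (z w : C) : Im (z * w) = Re z * Im w + Im z * Re w.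
Proof. by case: z; case: w. Qed.

Lemma differentiableC_mul f g x :
  differentiableC f x -> differentiableC g x -> differentiableC (fun y => f y * g y) x.
Proof.
move=> [f1 f2] [g1 g2]; split.
  have -> : (fun y => Re (f y * g y)) = (fun y => Re (f y)) * (fun y => Re (g y))
      - (fun y => Im (f y)) * (fun y => Im (g y)).
    by apply/funext => y; rewrite !fctE ReM.
  by apply: differentiableB; exact: differentiableM.
have -> : (fun y => Im (f y * g y)) = (fun y => Re (f y)) * (fun y => Im (g y))
      + (fun y => Im (f y)) * (fun y => Re (g y)).
  by apply/funext => y; rewrite !fctE ImM.
by apply: differentiableD; exact: differentiableM.
Qed.

Lemma derive_mulB (a b c d : 'rV[R]_4 -> R) v x :
  derivable a x v -> derivable b x v -> derivable c x v -> derivable d x v ->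
  'D_v (a * c - b * d) x
  = a x * 'D_v c x + c x * 'D_v a x - (b x * 'D_v d x + d x * 'D_v b x).
Proof.
move=> da db dc dd; have dac := derivableM da dc; have dbd := derivableM db dd.
by rewrite (deriveB dac dbd) (deriveM da dc) (deriveM db dd).
Qed.

Lemma derive_mulD (a b c d : 'rV[R]_4 -> R) v x :
  derivable a x v -> derivable b x v -> derivable c x v -> derivable d x v ->
  'D_v (a * d + b * c) x
  = a x * 'D_v d x + d x * 'D_v a x + (b x * 'D_v c x + c x * 'D_v b x).
Proof.
move=> da db dc dd; have dad := derivableM da dd; have dbc := derivableM db dc.
by rewrite (deriveD dad dbc) (deriveM da dd) (deriveM db dc).
Qed.

Lemma pd_mul i f g x : differentiableC f x -> differentiableC g x ->
  pd i (fun y => f y * g y) x = g x * pd i f x + f x * pd i g x.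
Proof.
move=> [f1 f2] [g1 g2]; rewrite /pd.
have -> : (fun y => Re (f y * g y)) = (fun y => Re (f y)) * (fun y => Re (g y))
    - (fun y => Im (f y)) * (fun y => Im (g y)).
  by apply/funext => y; rewrite !fctE ReM.
have -> : (fun y => Im (f y * g y)) = (fun y => Re (f y)) * (fun y => Im (g y))
    + (fun y => Im (f y)) * (fun y => Re (g y)).
  by apply/funext => y; rewrite !fctE ImM.
have d1 := @diff_derivable _ _ _ _ _ (delta_mx 0 i) f1.
have d2 := @diff_derivable _ _ _ _ _ (delta_mx 0 i) f2.
have d3 := @diff_derivable _ _ _ _ _ (delta_mx 0 i) g1.
have d4 := @diff_derivable _ _ _ _ _ (delta_mx 0 i) g2.
rewrite (derive_mulB d1 d2 d3 d4) (derive_mulD d1 d2 d3 d4).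
case: (f x) (g x) => [p q] [r s] /=; apply/eqP; rewrite eq_complex /=.
by apply/andP; split; apply/eqP; ring.
Qed.

Lemma ReV (z : C) : Re z^-1 = Re z * (Re z * Re z + Im z * Im z)^-1.
Proof. by case: z => a b /=; rewrite -!expr2. Qed.

Lemma ImV (z : C) : Im z^-1 = - Im z * (Re z * Re z + Im z * Im z)^-1.
Proof. by case: z => a b /=; rewrite -!expr2 mulNr. Qed.

Lemma differentiableC_inv f x :
  differentiableC f x -> f x != 0 -> differentiableC (fun y => (f y)^-1) x.
Proof.
move=> [f1 f2] fx0.
have dn : differentiable (fun y => (Re (f y) * Re (f y) + Im (f y) * Im (f y))^-1) x.
  apply: differentiableV; last first.
    move: fx0; apply: contra; rewrite -!expr2 paddr_eq0 ?sqr_ge0 // !sqrf_eq0.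
    by move=> h; rewrite eq_complex.
  exact: (differentiableD (differentiableM f1 f1) (differentiableM f2 f2)).
split.
  rewrite (_ : (fun y => Re (f y)^-1) = (fun y => Re (f y))
    * (fun y => (Re (f y) * Re (f y) + Im (f y) * Im (f y))^-1)).
    exact: differentiableM.
  by apply/funext => y; rewrite !fctE ReV.
rewrite (_ : (fun y => Im (f y)^-1) = (- (fun y => Im (f y)))
  * (fun y => (Re (f y) * Re (f y) + Im (f y) * Im (f y))^-1)).
  by apply: differentiableM => //; exact: differentiableN.
by apply/funext => y; rewrite !fctE ImV.
Qed.

Lemma differentiableC_near_neq0 f x :
  differentiableC f x -> f x != 0 -> \forall y \near x, f y != 0.
Proof.
move=> [f1 f2] fx0.
have : Re (f x) != 0 \/ Im (f x) != 0.
  apply/orP; rewrite -negb_and; apply: contra fx0 => h.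
  by rewrite eq_complex.
case=> h.
  have H : \forall y \near x, Re (f y) != 0.
    exact: (cvgr_neq0 _ (differentiable_continuous f1) h).
  by apply: filterS H => y; apply: contra => /eqP ->.
have H : \forall y \near x, Im (f y) != 0.
  exact: (cvgr_neq0 _ (differentiable_continuous f2) h).
by apply: filterS H => y; apply: contra => /eqP ->.
Qed.

(** Differentiating [f * f^-1 = 1], valid near [x] because [f] stays nonzero there, avoids a
    quotient rule on real and imaginary parts. *)
Lemma pd_inv i f x : differentiableC f x -> f x != 0 ->
  pd i (fun y => (f y)^-1) x = - (f x) ^- 2 * pd i f x.
Proof.
move=> df fx0; have dV := differentiableC_inv df fx0.
have : pd i (fun y => f y * (f y)^-1) x = 0.
  rewrite (@pd_near i _ (fun=> 1)) ?pd_cst //.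
  by apply: filterS (differentiableC_near_neq0 df fx0) => y fy; rewrite divff.
rewrite pd_mul // => /eqP; rewrite addrC addr_eq0 => /eqP h.
apply: (mulfI fx0); rewrite h; field.
exact: fx0.
Qed.

End Calculus.

(** * Symmetry of second derivatives *)

Section Schwarz.
Variables (R : realType) (V : normedModType R).
Implicit Types (F : V -> R) (v w x y : V).

Lemma derive_shiftl F v c x : 'D_v (fun y => F (y + c)) x = 'D_v F (x + c).
Proof.
rewrite /derive.
have -> : (fun h : R => h^-1 *: (((fun y => F (y + c)) \o shift x) (h *: v) - F (x + c)))
  = (fun h : R => h^-1 *: ((F \o shift (x + c)) (h *: v) - F (x + c))).
  by apply/funext => h /=; rewrite addrA.
by [].
Qed.

Lemma differentiable_shiftl F c x :
  differentiable F (x + c) -> differentiable (fun y => F (y + c)) x.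
Proof.
move=> dF; have d1 : differentiable (fun y : V => y + c) x.
  by apply: (@differentiableD _ _ _ (@id V) (cst c)) => //; exact: differentiable_cst.
exact: (@differentiable_comp _ _ _ _ _ F x d1 dF).
Qed.

Lemma MVT_line F v y (h : R) : 0 < h ->
  (forall t, t \in `[0, h] -> differentiable F (y + t *: v)) ->
  exists2 t, t \in `[0, h] &
    F (y + h *: v) - F y = h * 'D_v F (y + t *: v).
Proof.
move=> h0 dF.
have dl (t : R) : is_diff t (fun s : R => y + s *: v) (fun s => s *: v).
  have -> : (fun s : R => y + s *: v) = cst y + ( *:%R ^~ v) by [].
  exact: is_diff_eq (is_diffD (is_diff_cst y t) (is_diff_scalel t v)) (add0r _).
have dg t : t \in `[0, h] -> is_derive t 1 (fun s => F (y + s *: v)) ('D_v F (y + t *: v)).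
  move=> th; have dFt := dF _ th.
  have dc := @differentiable_comp _ _ _ _ (fun s : R => y + s *: v) F t (@ex_diff _ _ _ _ _ _ _ (dl t)) dFt.
  apply: DeriveDef; first exact: diff_derivable.
  rewrite (deriveE _ dc) (deriveE _ dFt).
  rewrite (@diff_comp _ _ _ _ (fun s : R => y + s *: v) F t (@ex_diff _ _ _ _ _ _ _ (dl t)) dFt) /=.
  by rewrite (@diff_val _ _ _ _ _ _ _ (dl t)) scale1r.
pose g := fun s : R => F (y + s *: v); pose g' := fun s : R => 'D_v F (y + s *: v).
have dg1 t : t \in `]0, h[ -> is_derive t 1 g (g' t).
  by move=> /subset_itv_oo_cc; exact: dg.
have gc : {within `[0, h], continuous g}.
  by apply: derivable_within_continuous => t th; have [] := dg t th.
have [t th E] := MVT_segment (ltW h0) dg1 gc.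
exists t => //.
by move: E; rewrite /g /g' scale0r addr0 subr0 mulrC.
Qed.

(** Two uses of the mean value theorem: along [v] for the increment of [F] by [h *: w], then along
    [w] for ['D_v F]. *)
Lemma second_difference F v w x (h : R) : 0 < h ->
  (forall s t, s \in `[0, h] -> t \in `[0, h] ->
     differentiable F (x + s *: v + t *: w)
     /\ differentiable ('D_v F) (x + s *: v + t *: w)) ->
  exists s t, [/\ s \in `[0, h], t \in `[0, h] &
    F (x + h *: v + h *: w) - F (x + h *: v) - (F (x + h *: w) - F x)
    = h * (h * 'D_w ('D_v F) (x + s *: v + t *: w))].
Proof.
move=> h0 dF.
have h0' : 0 \in `[0, h] by rewrite in_itv /= lexx ltW.
have hh : h \in `[0, h] by rewrite in_itv /= lexx ltW.
pose G := (fun y => F (y + h *: w)) - F.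
have d1 s : s \in `[0, h] -> differentiable (fun y => F (y + h *: w)) (x + s *: v).
  by move=> sh; apply: differentiable_shiftl; case: (dF s h sh hh).
have d2 s : s \in `[0, h] -> differentiable F (x + s *: v).
  by move=> sh; case: (dF s 0 sh h0'); rewrite scale0r addr0.
have [|s sh E] := @MVT_line G v x h h0.
  by move=> s sh; apply: differentiableB; [exact: d1|exact: d2].
have [|t th E'] := @MVT_line ('D_v F) w (x + s *: v) h h0.
  by move=> t th; case: (dF s t sh th).
exists s, t; split => //.
rewrite -E' -derive_shiftl -deriveB; [|exact: diff_derivable (d1 _ sh)|exact: diff_derivable (d2 _ sh)].
exact: E.
Qed.

Lemma second_difference_eq (h p q a a' b c d : R) : 0 < h -> a = a' ->
  a - b - (c - d) = h * (h * p) -> a' - c - (b - d) = h * (h * q) -> p = q.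
Proof.
move=> h0 <- E1 E2; apply: (mulfI (lt0r_neq0 h0)); apply: (mulfI (lt0r_neq0 h0)).
rewrite -E1 -E2; ring.
Qed.

Lemma dist_le_halves (e p q p' q' : R) : p' = q' ->
  `|p - p'| < e / 2 -> `|q - q'| < e / 2 -> `|p - q| <= e.
Proof.
move=> -> hp hq; rewrite [e]splitr -(subrK q' p) -addrA -(opprB q q').
by apply: le_trans (ler_normB _ _) _; apply: lerD; exact: ltW.
Qed.

(** The second difference over a small parallelogram is symmetric in the two directions. Divided by
    [h^2] it is a value of either mixed derivative at a point of the parallelogram, and continuity
    at [x] brings both values within any [e]. *)
Lemma derive_comm F v w (U : set V) x : open U -> U x ->
  (forall y, U y -> differentiable F y) ->
  (forall y, U y -> differentiable ('D_v F) y) ->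
  (forall y, U y -> differentiable ('D_w F) y) ->
  {for x, continuous ('D_w ('D_v F))} ->
  {for x, continuous ('D_v ('D_w F))} ->
  'D_w ('D_v F) x = 'D_v ('D_w F) x.
Proof.
move=> oU Ux dF dvF dwF c1 c2.
apply/eqP; rewrite -subr_eq0 -normr_le0; apply/ler_addgt0Pr => e e0; rewrite add0r.
have e20 : 0 < e / 2 by rewrite divr_gt0.
have n1 : \forall y \near x, `|'D_w ('D_v F) x - 'D_w ('D_v F) y| < e / 2.
  by have /cvgrPdist_lt := c1; apply.
have n2 : \forall y \near x, `|'D_v ('D_w F) x - 'D_v ('D_w F) y| < e / 2.
  by have /cvgrPdist_lt := c2; apply.
have n3 : \forall y \near x, U y by exact: open_nbhs_nbhs.
have [d /= d0 Hd] := proj1 (nbhs_ballP _ _) (filterI n1 (filterI n2 n3)).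
(* The [+ 1] keeps [m] positive even when both directions are zero; with [h = d / (2 m)] both
   parallelograms stay in the ball of radius [d]. *)
pose m := `|v| + `|w| + 1.
have m0 : 0 < m by rewrite ltr_wpDl // addr_ge0.
pose h := d / m / 2.
have h0 : 0 < h by rewrite !divr_gt0.
have hd : h * (`|v| + `|w|) < d.
  have -> : d = h * 2 * m by rewrite /h divfK // divfK // lt0r_neq0.
  have : h * (`|v| + `|w|) < h * m by rewrite ltr_pM2l // /m ltrDl.
  move=> /lt_le_trans; apply.
  rewrite (_ : h * 2 * m = h * m + h * m); last by ring.
  by rewrite lerDl mulr_ge0 // ltW.
have inb (v' w' : V) s t : `|v'| + `|w'| = `|v| + `|w| -> s \in `[0, h] -> t \in `[0, h] ->
    ball x d (x + s *: v' + t *: w').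
  move=> vw; rewrite !in_itv /= => /andP[s0 sh] /andP[t0 th].
  rewrite -ball_normE /= opprD opprD !addrA subrr sub0r -opprD normrN.
  apply: le_lt_trans (ler_normD _ _) _; rewrite !normrZ !ger0_norm //.
  apply: le_lt_trans _ hd; rewrite -vw mulrDr lerD //; exact: ler_wpM2r.
have [s [t [sh th E1]]] := @second_difference F v w x h h0
  (fun s t hs ht => conj (dF _ (proj2 (proj2 (Hd _ (inb v w s t erefl hs ht)))))
     (dvF _ (proj2 (proj2 (Hd _ (inb v w s t erefl hs ht)))))).
have wv : `|w| + `|v| = `|v| + `|w| by rewrite addrC.
have [s' [t' [sh' th' E2]]] := @second_difference F w v x h h0
  (fun s t hs ht => conj (dF _ (proj2 (proj2 (Hd _ (inb w v s t wv hs ht)))))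
     (dwF _ (proj2 (proj2 (Hd _ (inb w v s t wv hs ht)))))).
have E := second_difference_eq h0 (congr1 F (addrAC _ _ _)) E1 E2.
have [b1 _] := Hd _ (inb v w s t erefl sh th).
have [_ [b2 _]] := Hd _ (inb w v s' t' wv sh' th').
exact: dist_le_halves E b1 b2.
Qed.

End Schwarz.

(** * Closure properties of smooth functions *)

Section Smooth.
Variable R : realType.
Local Notation C := R[i].
Implicit Types (f g : 'rV[R]_4 -> C) (x : 'rV[R]_4) (U : set 'rV[R]_4).

(** Smoothness graded by order, peeling off the innermost derivative: this gives the closure
    properties an induction in which the function itself changes. *)
Fixpoint Ck U n f : Prop :=
  (forall x, U x -> differentiableC f x)
  /\ if n is m.+1 then forall i, Ck U m (pd i f) else True.

Lemma smooth_onP U f : smooth_on U f <-> forall n, Ck U n f.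
Proof.
split=> [sf n|Cf s].
  elim: n f sf => [|n IH] f sf; split=> //.
  - exact: (sf [::]).
  - exact: (sf [::]).
  by move=> i; apply: IH => s x Ux; have := sf (rcons s i) x Ux; rewrite foldr_rcons.
elim/last_ind: s f Cf => [|s i IH] f Cf x Ux; first exact: (proj1 (Cf 0%N)).
by rewrite foldr_rcons; apply: IH => // n; exact: (proj2 (Cf n.+1)).
Qed.

(** The product rule leaves one factor undifferentiated, and that factor is needed one order
    lower. *)
Lemma CkW U n f : Ck U n.+1 f -> Ck U n f.
Proof.
by elim: n f => [|n IH] f [d Cf]; split=> // i; apply: IH; exact: Cf.
Qed.

Lemma Ck_eq U n f g : open U -> (forall x, U x -> f x = g x) -> Ck U n f -> Ck U n g.
Proof.
move=> oU; have near_U x h h' : U x -> (forall y, U y -> h y = h' y) ->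
    \forall y \near x, h y = h' y :> C.
  by move=> Ux hh'; apply: filterS (open_nbhs_nbhs (conj oU Ux)) => y; exact: hh'.
elim: n f g => [|n IH] f g fg [df Cf];
  (split; first by move=> x Ux; apply: differentiableC_near (df x Ux); exact: near_U) => // i.
apply: IH (Cf i) => x Ux; apply: pd_near; exact: near_U.
Qed.

Lemma Ck_cst U n (k : C) : open U -> Ck U n (fun=> k).
Proof.
move=> oU; elim: n k => [|n IH] k; (split; first by move=> x _; exact: differentiableC_cst) => // i.
by apply: Ck_eq (IH 0) => // x _; rewrite pd_cst.
Qed.

Lemma Ck_coord U n i : open U -> Ck U n (fun x => (x 0 i)%:C).
Proof.
move=> oU; case: n => [|n]; (split; first by move=> x _; exact: differentiableC_coord) => // j.
by apply: Ck_eq (Ck_cst n (j == i)%:R oU) => // x _; rewrite pd_coord.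
Qed.

Lemma Ck_add U n f g : open U -> Ck U n f -> Ck U n g -> Ck U n (fun x => f x + g x).
Proof.
move=> oU; elim: n f g => [|n IH] f g [df Cf] [dg Cg];
  (split; first by move=> x Ux; apply: differentiableC_add; auto) => // i.
by apply: Ck_eq (IH _ _ (Cf i) (Cg i)) => // x Ux; rewrite pd_add; auto.
Qed.

Lemma Ck_mul U n f g : open U -> Ck U n f -> Ck U n g -> Ck U n (fun x => f x * g x).
Proof.
move=> oU; elim: n f g => [|n IH] f g Cf0 Cg0;
  move: (Cf0) (Cg0) => [df Cf] [dg Cg];
  (split; first by move=> x Ux; apply: differentiableC_mul; auto) => // i.
apply: (@Ck_eq _ _ (fun x => g x * pd i f x + f x * pd i g x)) => //.
  by move=> x Ux; rewrite pd_mul; auto.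
exact: Ck_add oU (IH _ _ (CkW Cg0) (Cf i)) (IH _ _ (CkW Cf0) (Cg i)).
Qed.

(** The derivative of the inverse contains the inverse itself only at the previous order, so the
    induction closes. *)
Lemma Ck_inv U n f : open U -> (forall x, U x -> f x != 0) ->
  Ck U n f -> Ck U n (fun x => (f x)^-1).
Proof.
move=> oU f0; elim: n => [|n IH] Cf0; move: (Cf0) => [df Cf];
  (split; first by move=> x Ux; apply: differentiableC_inv; auto) => // i.
apply: (@Ck_eq _ _ (fun x => (-1) * ((f x)^-1 * (f x)^-1) * pd i f x)) => //.
  by move=> x Ux; rewrite (pd_inv i (df x Ux) (f0 x Ux)) -invfM -expr2 mulN1r.
have CV := IH (CkW Cf0).
exact: Ck_mul oU (Ck_mul oU (Ck_cst n (-1) oU) (Ck_mul oU CV CV)) (Cf i).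
Qed.

Lemma smooth_eq U f g : open U -> (forall x, U x -> f x = g x) ->
  smooth_on U f -> smooth_on U g.
Proof. by move=> oU fg /smooth_onP Cf; apply/smooth_onP => n; exact: Ck_eq (Cf n). Qed.

Lemma smooth_cst U (k : C) : open U -> smooth_on U (fun=> k).
Proof. by move=> oU; apply/smooth_onP => n; exact: Ck_cst. Qed.

Lemma smooth_coord U i : open U -> smooth_on U (fun x => (x 0 i)%:C).
Proof. by move=> oU; apply/smooth_onP => n; exact: Ck_coord. Qed.

Lemma smooth_add U f g : open U -> smooth_on U f -> smooth_on U g ->
  smooth_on U (fun x => f x + g x).
Proof. by move=> oU /smooth_onP Cf /smooth_onP Cg; apply/smooth_onP => n; exact: Ck_add. Qed.

Lemma smooth_mul U f g : open U -> smooth_on U f -> smooth_on U g ->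
  smooth_on U (fun x => f x * g x).
Proof. by move=> oU /smooth_onP Cf /smooth_onP Cg; apply/smooth_onP => n; exact: Ck_mul. Qed.

Lemma smooth_inv U f : open U -> (forall x, U x -> f x != 0) -> smooth_on U f ->
  smooth_on U (fun x => (f x)^-1).
Proof. by move=> oU f0 /smooth_onP Cf; apply/smooth_onP => n; exact: Ck_inv. Qed.

Lemma smooth_opp U f : open U -> smooth_on U f -> smooth_on U (fun x => - f x).
Proof.
move=> oU sf; apply: (@smooth_eq _ (fun x => (-1) * f x)) => //.
  by move=> x _; rewrite mulN1r.
by apply: smooth_mul => //; exact: smooth_cst.
Qed.

Lemma smooth_exp U f n : open U -> smooth_on U f -> smooth_on U (fun x => f x ^+ n).
Proof.
move=> oU sf; elim: n => [|n IH].
  by apply: (@smooth_eq _ (fun=> 1)) => //; exact: smooth_cst.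
apply: (@smooth_eq _ (fun x => f x * f x ^+ n)) => //; first by move=> x _; rewrite exprS.
exact: smooth_mul.
Qed.

Lemma smooth_sum U (I : Type) (r : seq I) (F : I -> 'rV[R]_4 -> C) : open U ->
  (forall i, smooth_on U (F i)) -> smooth_on U (fun x => \sum_(i <- r) F i x).
Proof.
move=> oU sF; elim: r => [|i r IH].
  by apply: (@smooth_eq _ (fun=> 0)) => //; [move=> x _; rewrite big_nil | exact: smooth_cst].
apply: (@smooth_eq _ (fun x => F i x + \sum_(j <- r) F j x)) => //.
  by move=> x _; rewrite big_cons.
exact: smooth_add.
Qed.

Lemma smooth_pd U i f : smooth_on U f -> smooth_on U (pd i f).
Proof. by move=> sf s x Ux; have := sf (rcons s i) x Ux; rewrite foldr_rcons. Qed.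

Lemma smooth_differentiable U f x : smooth_on U f -> U x -> differentiableC f x.
Proof. by move=> sf Ux; exact: (sf [::]). Qed.

(** Schwarz on real and imaginary parts; the mixed derivatives are continuous because they are again
    differentiable. *)
Lemma pd_comm U i j f x : open U -> U x -> smooth_on U f ->
  pd i (pd j f) x = pd j (pd i f) x.
Proof.
move=> oU Ux sf.
have d0 y : U y -> differentiableC f y by exact: smooth_differentiable.
have d1 k y : U y -> differentiableC (pd k f) y.
  by apply: smooth_differentiable; exact: smooth_pd.
have d2 k l : differentiableC (pd k (pd l f)) x.
  by apply: smooth_differentiable Ux; do 2! apply: smooth_pd.
have E1 : 'D_(delta_mx 0 i) ('D_(delta_mx 0 j) (fun y => complex.Re (f y))) x
    = 'D_(delta_mx 0 j) ('D_(delta_mx 0 i) (fun y => complex.Re (f y))) x.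
  exact: (derive_comm oU Ux (fun y Uy => proj1 (d0 y Uy)) (fun y Uy => proj1 (d1 j y Uy))
    (fun y Uy => proj1 (d1 i y Uy)) (differentiable_continuous (proj1 (d2 i j)))
    (differentiable_continuous (proj1 (d2 j i)))).
have E2 : 'D_(delta_mx 0 i) ('D_(delta_mx 0 j) (fun y => complex.Im (f y))) x
    = 'D_(delta_mx 0 j) ('D_(delta_mx 0 i) (fun y => complex.Im (f y))) x.
  exact: (derive_comm oU Ux (fun y Uy => proj2 (d0 y Uy)) (fun y Uy => proj2 (d1 j y Uy))
    (fun y Uy => proj2 (d1 i y Uy)) (differentiable_continuous (proj2 (d2 i j)))
    (differentiable_continuous (proj2 (d2 j i)))).
exact: (f_equal2 _ E1 E2).
Qed.

End Smooth.

(** * The Hamiltonians in the symmetric coordinates *)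

Section Algebra.
Variable K : numFieldType.

Definition sumV (u1 u2 : K) := u1^-1 + u2^-1.
Definition prodV (u1 u2 : K) := u1^-1 * u2^-1.
Definition slope (u1 u2 p1 p2 : K) := (u1 ^+ 3 * p1 - u2 ^+ 3 * p2) * (u1 - u2)^-1.
Definition icpt (u1 u2 p1 p2 : K) :=
  - (u1 * u2 * (u1 ^+ 2 * p1 - u2 ^+ 2 * p2) * (u1 - u2)^-1).

(* Writing [w = z^4 p], the separation curve is [w^2 = ham1 z^4 + ham2 z^3 - a z^2 - b z - c],
   on which both [(u_i, p_i)] and [(uhat_i, phat_i)] lie. *)
Definition kappa (a b c e1 e2 T : K) := T ^+ 2 + a + b * e1 + c * (e1 ^+ 2 - e2).
Definition ham1 (a b c e1 e2 S T : K) := S ^+ 2 - e2 * kappa a b c e1 e2 T.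
Definition ham2 (a b c e1 e2 S T : K) :=
  2 * S * T + e1 * kappa a b c e1 e2 T - e2 * (b + c * e1).
(** With [y0 + y1 = - (b / c + e1)] and [c y0 y1 = kappa], these are [2 (l0 + l1)] and
    [- (l0 - l1)^2] for [l_i = (ham1 + ham2 y_i) / 2]. The last factor of [Hpol2] is
    [(y0 - y1)^2]. *)
Definition Hpol1 (a b c e1 e2 S T : K) :=
  2 * ham1 a b c e1 e2 S T - (b / c + e1) * ham2 a b c e1 e2 S T.
Definition Hpol2 (a b c e1 e2 S T : K) :=
  - 4^-1 * ham2 a b c e1 e2 S T ^+ 2
  * ((b / c + e1) ^+ 2 - 4 / c * kappa a b c e1 e2 T).

Section At.
Variables a b c u1 u2 p1 p2 : K.
Hypotheses (c0 : c != 0) (u10 : u1 != 0) (u20 : u2 != 0) (u12 : u1 != u2).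
Let e1 := sumV u1 u2.
Let e2 := prodV u1 u2.
Let S := slope u1 u2 p1 p2.
Let T := icpt u1 u2 p1 p2.
Let d12 : u1 - u2 != 0. Proof. by rewrite subr_eq0. Qed.
Let d21 : u2 - u1 != 0. Proof. by rewrite subr_eq0 eq_sym. Qed.

Lemma h1_sym : h1 a b c u1 u2 p1 p2 = ham1 a b c e1 e2 S T.
Proof.
rewrite /h1 /ham1 /kappa /e1 /e2 /S /T /sumV /prodV /slope /icpt.
by field; rewrite ?c0 ?d12 ?d21 ?u10 ?u20.
Qed.

Lemma quad_sym z : quad a b c u1 u2 p1 p2 z
  = - e2 * (kappa a b c e1 e2 T * z ^+ 2 + (b + c * e1) * z + c).
Proof.
rewrite /quad h1_sym /ham1 /kappa /e1 /e2 /S /T /sumV /prodV /slope /icpt.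
by field; rewrite ?c0 ?d12 ?u10 ?u20.
Qed.

Lemma Qpol_sym z : Qpol u1 u2 p1 p2 z = z * (S * z + T).
Proof.
rewrite /Qpol /S /T /slope /icpt.
by field; rewrite ?d12 ?d21.
Qed.

Lemma H1_sym : H1 a b c u1 u2 p1 p2 = Hpol1 a b c e1 e2 S T.
Proof.
rewrite /H1 /Hpol1 /ham1 /ham2 /kappa /e1 /e2 /S /T /sumV /prodV /slope /icpt.
by field; rewrite ?c0 ?d12 ?d21 ?u10 ?u20.
Qed.

(** [G] carries [ham2] and [F] carries [(y0 - y1)^2]; the factor [c u1 u2 (u1 - u2)] that spoils
    each of them cancels in [F G^2]. *)
Lemma Gfac_sym : Gfac a b c u1 u2 p1 p2
  = - ham2 a b c e1 e2 S T / (c * u1 * u2 * (u1 - u2)).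
Proof.
rewrite /Gfac /ham2 /kappa /e1 /e2 /S /T /sumV /prodV /slope /icpt.
by field; rewrite ?c0 ?d12 ?u10 ?u20.
Qed.

Lemma Ffac_sym : Ffac a b c u1 u2 p1 p2
  = - (c * u1 * u2 * (u1 - u2)) ^+ 2 / 4
    * ((b / c + e1) ^+ 2 - 4 / c * kappa a b c e1 e2 T).
Proof.
rewrite /Ffac /kappa /e1 /e2 /S /T /sumV /prodV /slope /icpt.
by field; rewrite ?c0 ?d12 ?u10 ?u20.
Qed.

Lemma H2_sym : H2 a b c u1 u2 p1 p2 = Hpol2 a b c e1 e2 S T.
Proof.
rewrite /H2 Ffac_sym Gfac_sym /Hpol2; set k := kappa _ _ _ _ _ _; set h := ham2 _ _ _ _ _ _ _.
by field; rewrite ?c0 ?d12 ?u10 ?u20.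
Qed.

End At.

Lemma lambda_root (a b c e1 e2 S T Y : K) : Y != 0 ->
  c * Y ^+ 2 + (b + c * e1) * Y + kappa a b c e1 e2 T = 0 ->
  lambda a b c Y^-1 (- (Y ^+ 2 * (S + T * Y)))
  = (ham1 a b c e1 e2 S T + ham2 a b c e1 e2 S T * Y) / 2.
Proof.
move=> Y0 rY; rewrite /lambda; congr (_ / 2); apply/eqP; rewrite -subr_eq0; apply/eqP.
(* The other two intersection points are [Y = 1/u1] and [Y = 1/u2]. *)
transitivity ((c * Y ^+ 2 + (b + c * e1) * Y + kappa a b c e1 e2 T)
  * (Y ^+ 2 - e1 * Y + e2)); last by rewrite rY mul0r.
by rewrite /ham1 /ham2 /kappa; field.
Qed.

(** Eliminating one coefficient between the two root equations leaves a multiple of [z0 - z1], which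
    is cancelled. For the reciprocals [c] is the leading coefficient, so the formulas never divide
    by [k]. *)
Lemma vieta_inv (b c e1 k z0 z1 : K) : c != 0 -> z0 != z1 ->
  k * z0 ^+ 2 + (b + c * e1) * z0 + c = 0 ->
  k * z1 ^+ 2 + (b + c * e1) * z1 + c = 0 ->
  [/\ z0 != 0, z1 != 0, z0^-1 + z1^-1 = - (b / c + e1) & c * (z0^-1 * z1^-1) = k].
Proof.
move=> c0 z01 r0 r1.
have n0 z : k * z ^+ 2 + (b + c * e1) * z + c = 0 -> z != 0.
  by move=> h; apply: contra_neq c0 => z0'; move: h; rewrite z0' expr0n !mulr0 !add0r.
have z00 := n0 _ r0; have z10 := n0 _ r1.
have d : z0 - z1 != 0 by rewrite subr_eq0.
have kz : k * z0 * z1 = c.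
  apply: (mulfI d); apply/eqP; rewrite -subr_eq0; apply/eqP.
  transitivity (z1 * (k * z0 ^+ 2 + (b + c * e1) * z0 + c)
     - z0 * (k * z1 ^+ 2 + (b + c * e1) * z1 + c)); last by rewrite r0 r1 !mulr0 subr0.
  ring.
have bz : k * (z0 + z1) = - (b + c * e1).
  apply: (mulfI d); apply/eqP; rewrite -subr_eq0; apply/eqP.
  transitivity ((k * z0 ^+ 2 + (b + c * e1) * z0 + c)
     - (k * z1 ^+ 2 + (b + c * e1) * z1 + c)); last by rewrite r0 r1 subr0.
  ring.
split=> //.
- apply: (mulfI c0); transitivity (- (b + c * e1)); last by field.
  by rewrite -bz -{1}kz; field; rewrite z00 z10.
- by rewrite -kz; field; rewrite z00 z10.
Qed.

Lemma Hpol_roots (a b c e1 e2 S T Y0 Y1 l0 l1 : K) : c != 0 ->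
  Y0 + Y1 = - (b / c + e1) -> c * (Y0 * Y1) = kappa a b c e1 e2 T ->
  l0 = (ham1 a b c e1 e2 S T + ham2 a b c e1 e2 S T * Y0) / 2 ->
  l1 = (ham1 a b c e1 e2 S T + ham2 a b c e1 e2 S T * Y1) / 2 ->
  Hpol1 a b c e1 e2 S T = 2 * (l0 + l1) /\ Hpol2 a b c e1 e2 S T = - (l0 - l1) ^+ 2.
Proof.
move=> c0 s p -> ->; rewrite /Hpol1 /Hpol2 -p -[b / c + e1]opprK -s.
set h1 := ham1 _ _ _ _ _ _ _; set h2 := ham2 _ _ _ _ _ _ _.
by split; field.
Qed.

End Algebra.

(** * Differentials in a frame *)

Lemma sum4 (V : nmodType) (F : 'I_4 -> V) : \sum_i F i = F 0 + F 1 + F 2 + F 3.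
Proof.
rewrite !big_ord_recr big_ord0 /= add0r.
by congr (F _ + F _ + F _ + F _); exact: val_inj.
Qed.

Section Frames.
Variable R : realType.
Local Notation C := R[i].
Implicit Types (f g : 'rV[R]_4 -> C) (x : 'rV[R]_4) (E : 'M[C]_4) (w : 'I_4 -> C).

(* The rows of [E] play the role of the differentials of a coordinate system
   and [w] that of the partial derivatives of [f] in these coordinates. *)
Definition dframe E f x w := differentiableC f x /\ grad f x = \row_i w i *m E.

Definition frame (fs : 'I_4 -> 'rV[R]_4 -> C) x : 'M[C]_4 :=
  \matrix_i grad (fs i) x.

Lemma grad_near f g x : {near x, f =1 g} -> grad f x = grad g x.
Proof. by move=> fg; apply/rowP => i; rewrite !mxE; exact: pd_near. Qed.

Lemma dframe_near E f g x w : {near x, f =1 g} -> dframe E f x w -> dframe E g x w.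
Proof.
by move=> fg [df gf]; split; [exact: differentiableC_near fg df | rewrite -(grad_near fg)].
Qed.

Lemma dframe_eq E f x w w' : w =1 w' -> dframe E f x w -> dframe E f x w'.
Proof. by move=> /funext ->. Qed.

Lemma dframe_cst E (k : C) x : dframe E (fun=> k) x (fun=> 0).
Proof.
split; first exact: differentiableC_cst.
have -> : \row_(i < 4) 0 = 0 :> 'rV[C]_4 by apply/rowP => i; rewrite !mxE.
by rewrite mul0mx; apply/rowP => i; rewrite !mxE pd_cst.
Qed.

Lemma dframe_add E f g x wf wg : dframe E f x wf -> dframe E g x wg ->
  dframe E (fun y => f y + g y) x (fun i => wf i + wg i).
Proof.
move=> [df gf] [dg gg]; split; first exact: differentiableC_add.
have -> : \row_i (wf i + wg i) = \row_i wf i + \row_i wg i :> 'rV[C]_4.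
  by apply/rowP => i; rewrite !mxE.
rewrite mulmxDl -gf -gg; apply/rowP => i; rewrite !mxE; exact: pd_add.
Qed.

Lemma dframe_mul E f g x wf wg : dframe E f x wf -> dframe E g x wg ->
  dframe E (fun y => f y * g y) x (fun i => g x * wf i + f x * wg i).
Proof.
move=> [df gf] [dg gg]; split; first exact: differentiableC_mul.
have -> : \row_i (g x * wf i + f x * wg i)
    = g x *: \row_i wf i + f x *: \row_i wg i :> 'rV[C]_4.
  by apply/rowP => i; rewrite !mxE.
rewrite mulmxDl -!scalemxAl -gf -gg; apply/rowP => i; rewrite !mxE; exact: pd_mul.
Qed.

Lemma dframe_opp E f x w : dframe E f x w -> dframe E (fun y => - f y) x (fun i => - w i).
Proof.
move=> Df; apply: (@dframe_near _ (fun y => (-1) * f y)).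
  by near=> y; rewrite mulN1r.
apply: dframe_eq (dframe_mul (dframe_cst E (-1) x) Df) => i.
by rewrite mulr0 add0r mulN1r.
Unshelve. all: by end_near. Qed.

Lemma dframe_inv E f x w : f x != 0 -> dframe E f x w ->
  dframe E (fun y => (f y)^-1) x (fun i => - (f x) ^- 2 * w i).
Proof.
move=> f0 [df gf]; split; first exact: differentiableC_inv.
have -> : \row_i (- (f x) ^- 2 * w i) = - (f x) ^- 2 *: \row_i w i :> 'rV[C]_4.
  by apply/rowP => i; rewrite !mxE.
rewrite -scalemxAl -gf; apply/rowP => i; rewrite !mxE; exact: pd_inv.
Qed.

Lemma dframe_exp E f x w n : dframe E f x w ->
  dframe E (fun y => f y ^+ n) x (fun i => n%:R * f x ^+ n.-1 * w i).
Proof.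
move=> Df; elim: n => [|n IH].
  by apply: dframe_eq (dframe_cst E 1 x) => i; rewrite !mul0r.
apply: (@dframe_near _ (fun y => f y * f y ^+ n)).
  by near=> y; rewrite exprS.
apply: dframe_eq (dframe_mul Df IH) => i.
by case: n {IH} => [|n] /=; rewrite -?exprS ?expr0 ?exprS; ring.
Unshelve. all: by end_near. Qed.

Lemma dframe_coord x i : dframe 1%:M (fun y => (y 0 i)%:C) x (fun j => (j == i)%:R).
Proof.
split; first exact: differentiableC_coord.
by rewrite mulmx1; apply/rowP => j; rewrite !mxE pd_coord.
Qed.

Lemma dframe_frame fs x i : differentiableC (fs i) x ->
  dframe (frame fs x) (fs i) x (fun j => (j == i)%:R).
Proof.
move=> d; split=> //.
have -> : \row_j (j == i)%:R = delta_mx 0 i :> 'rV[C]_4.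
  by apply/rowP => j; rewrite !mxE eqxx.
by rewrite -rowE rowK.
Qed.

Lemma frame_bracket P fs x :
  frame fs x *m P x *m (frame fs x)^T = \matrix_(i, j) bracket P (fs i) (fs j) x.
Proof.
apply/matrixP => i j; rewrite [RHS]mxE /bracket.
have rK k : grad (fs k) x = row k (frame fs x) by rewrite rowK.
rewrite !rK -row_mul [LHS]mxE [RHS]mxE; apply: eq_bigr => k _.
by rewrite !mxE.
Qed.

(** When [E] is the frame of some functions, [E P E^T] is the matrix of their mutual brackets by
    [frame_bracket]; the bracket of two composite functions then needs only those entries. *)
Lemma bracket_dframe P E f g x wf wg : dframe E f x wf -> dframe E g x wg ->
  bracket P f g x
  = (\row_i wf i *m (E *m P x *m E^T) *m (\row_i wg i)^T) 0 0.
Proof. by move=> [_ gf] [_ gg]; rewrite /bracket gf gg trmx_mul !mulmxA. Qed.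

Lemma Pi_canE x i j :
  Pi_can x i j = ((j == i + 2 :> nat)%N%:R - (i == j + 2 :> nat)%N%:R : C).
Proof.
rewrite /Pi_can [LHS]mxE.
case: (splitP (i : 'I_(2 + 2))) => i' Ei; rewrite mxE;
  case: (splitP (j : 'I_(2 + 2))) => j' Ej; rewrite !mxE Ei Ej;
  case: i' {Ei} => [[|[|]]] // ?; case: j' {Ej} => [[|[|]]] // ?;
  by rewrite /= ?subr0 ?sub0r ?oppr0.
Qed.

Lemma pairing_can (g h : 'rV[C]_4) x : (g *m Pi_can x *m h^T) 0 0
  = g 0 0 * h 0 2 + g 0 1 * h 0 3 - g 0 2 * h 0 0 - g 0 3 * h 0 1.
Proof.
rewrite mxE sum4 !mxE !sum4 !Pi_canE /=.
ring.
Qed.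

End Frames.

(** * Canonical brackets of the symmetric functions *)

Section SymmetricFrame.
Variable R : realType.
Local Notation C := R[i].
Implicit Types (f g : 'rV[R]_4 -> C) (x : 'rV[R]_4) (w : 'I_4 -> C).

Definition ucoord (i : 'I_4) x : C := (x 0 i)%:C.

Definition E1f x := sumV (ucoord 0 x) (ucoord 1 x).
Definition E2f x := prodV (ucoord 0 x) (ucoord 1 x).
Definition Sf x := slope (ucoord 0 x) (ucoord 1 x) (ucoord 2 x) (ucoord 3 x).
Definition Tf x := icpt (ucoord 0 x) (ucoord 1 x) (ucoord 2 x) (ucoord 3 x).

Definition symf (i : 'I_4) : 'rV[R]_4 -> C := nth (fun=> 0) [:: E1f; E2f; Sf; Tf] i.

(* Encodes [{e1, S} = -1], [{e2, S} = -e1], [{e2, T} = 1], the other brackets being zero. *)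
Definition sym_br (e1 : C) w w' : C :=
  (w 2 * w' 0 - w 0 * w' 2) + e1 * (w 2 * w' 1 - w 1 * w' 2)
  + (w 1 * w' 3 - w 3 * w' 1).

Lemma bracket_can1 f g x wf wg : dframe 1%:M f x wf -> dframe 1%:M g x wg ->
  bracket (@Pi_can R) f g x = wf 0 * wg 2 + wf 1 * wg 3 - wf 2 * wg 0 - wf 3 * wg 1.
Proof.
move=> Df Dg; rewrite (bracket_dframe _ Df Dg) trmx1 mulmx1 mul1mx pairing_can.
by rewrite !mxE.
Qed.

Section At.
Variable x : 'rV[R]_4.
Hypothesis rx : regular_points x.

Lemma ucoord0_neq0 : ucoord 0 x != 0.
Proof. by case: rx => h _ _; rewrite -(rmorph0 (real_complex R)) (inj_eq (@complexI R)). Qed.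

Lemma ucoord1_neq0 : ucoord 1 x != 0.
Proof. by case: rx => _ h _; rewrite -(rmorph0 (real_complex R)) (inj_eq (@complexI R)). Qed.

Lemma ucoord01 : ucoord 0 x != ucoord 1 x.
Proof. by case: rx => _ _ h; rewrite (inj_eq (@complexI R)). Qed.

Lemma ucoordB_neq0 : ucoord 0 x - ucoord 1 x != 0.
Proof. by rewrite subr_eq0 ucoord01. Qed.

(** Differentiation by assembly: each term below mirrors the formula of the function, and
    unification fills the hole in its type with the resulting coefficients. *)
Let Du i : dframe 1%:M (ucoord i) x (fun j => (j == i)%:R) := dframe_coord x i.
Let DE1 : dframe 1%:M E1f x _ := dframe_add (dframe_inv ucoord0_neq0 (Du 0)) (dframe_inv ucoord1_neq0 (Du 1)).
Let DE2 : dframe 1%:M E2f x _ := dframe_mul (dframe_inv ucoord0_neq0 (Du 0)) (dframe_inv ucoord1_neq0 (Du 1)).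
Let Dd := dframe_inv (ucoordB_neq0 : (fun y => ucoord 0 y - ucoord 1 y) x != 0) (dframe_add (Du 0) (dframe_opp (Du 1))).
Let DS : dframe 1%:M Sf x _ := dframe_mul (dframe_add (dframe_mul (dframe_exp 3 (Du 0)) (Du 2))
  (dframe_opp (dframe_mul (dframe_exp 3 (Du 1)) (Du 3)))) Dd.
Let DT : dframe 1%:M Tf x _ := dframe_opp (dframe_mul (dframe_mul (dframe_mul (Du 0) (Du 1))
  (dframe_add (dframe_mul (dframe_exp 2 (Du 0)) (Du 2))
  (dframe_opp (dframe_mul (dframe_exp 2 (Du 1)) (Du 3))))) Dd).

Lemma symf_differentiable i : differentiableC (symf i) x.
Proof.
case: i => [[|[|[|[|]]]]] // ?; rewrite /symf /=.
- exact: (proj1 DE1).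
- exact: (proj1 DE2).
- exact: (proj1 DS).
- exact: (proj1 DT).
Qed.

(** Generalising the four coordinates leaves a rational identity for [field], with only [u1], [u2]
    and [u1 - u2] in denominators. *)
Local Ltac eval_bracket := cbv beta;
  move: ucoordB_neq0 ucoord0_neq0 ucoord1_neq0;
  move: (ucoord 0 x) (ucoord 1 x) (ucoord 2 x) (ucoord 3 x) => ? ? ? ? ? ? ?;
  simpl; field; repeat (apply/andP; split); assumption.

Lemma bracket_symf01 : bracket (@Pi_can R) E1f E2f x = 0.
Proof. rewrite (bracket_can1 DE1 DE2); eval_bracket. Qed.

Lemma bracket_symf02 : bracket (@Pi_can R) E1f Sf x = -1.
Proof. rewrite (bracket_can1 DE1 DS); eval_bracket. Qed.

Lemma bracket_symf03 : bracket (@Pi_can R) E1f Tf x = 0.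
Proof. rewrite (bracket_can1 DE1 DT); eval_bracket. Qed.

Lemma bracket_symf12 : bracket (@Pi_can R) E2f Sf x = - E1f x.
Proof. rewrite (bracket_can1 DE2 DS) /E1f /sumV; eval_bracket. Qed.

Lemma bracket_symf13 : bracket (@Pi_can R) E2f Tf x = 1.
Proof. rewrite (bracket_can1 DE2 DT); eval_bracket. Qed.

Lemma bracket_symf23 : bracket (@Pi_can R) Sf Tf x = 0.
Proof. rewrite (bracket_can1 DS DT); eval_bracket. Qed.

Lemma bracket_canC f g : bracket (@Pi_can R) f g x = - bracket (@Pi_can R) g f x.
Proof. by rewrite /bracket !pairing_can; ring. Qed.

Lemma bracket_canxx f : bracket (@Pi_can R) f f x = 0.
Proof. by rewrite /bracket !pairing_can; ring. Qed.

Lemma bracket_sym f g wf wg : dframe (frame symf x) f x wf ->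
  dframe (frame symf x) g x wg ->
  bracket (@Pi_can R) f g x = sym_br (E1f x) wf wg.
Proof.
move=> Df Dg; rewrite (bracket_dframe _ Df Dg) frame_bracket.
have [s0 s1 s2 s3] : [/\ symf 0 = E1f, symf 1 = E2f, symf 2 = Sf & symf 3 = Tf] by [].
rewrite mxE sum4 !mxE !sum4 !mxE s0 s1 s2 s3 !bracket_canxx.
rewrite (bracket_canC E2f E1f) (bracket_canC Sf E1f).
rewrite (bracket_canC Tf E1f) (bracket_canC Sf E2f).
rewrite (bracket_canC Tf E2f) (bracket_canC Tf Sf).
rewrite bracket_symf01 bracket_symf02 bracket_symf03 bracket_symf12 bracket_symf13 bracket_symf23.
rewrite /sym_br; ring.
Qed.

End At.
End SymmetricFrame.

(** * Involution and independence *)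

Section Differences.
Variable K : numFieldType.

(* Minus the Jacobian of [(H1, H2)] in [(S, T)], with [ci = 1/c], [B = b/c + e1] and
   [l], [d] the terms free of [S], [T] in [ham2] and in the discriminant. *)
Definition jac (ci B e1 e2 l d S T : K) :=
  (2 * S * T + e1 * T ^+ 2 + l)
  * ((4 * S - 2 * B * T) * ((S + e1 * T) * (d - 4 * ci * T ^+ 2)
        - 2 * ci * T * (2 * S * T + e1 * T ^+ 2 + l))
     + (4 * e2 * T + B * (2 * S + 2 * e1 * T)) * T * (d - 4 * ci * T ^+ 2)).

(* The sixth finite difference along a line isolates the top-degree part. *)
Lemma jac_difference (ci B e1 e2 l d S T s t : K) :
  let J (n : K) := jac ci B e1 e2 l d (S + n * s) (T + n * t) in
  J 0 - 6 * J 1 + 15 * J 2 - 20 * J 3 + 15 * J 4 - 6 * J 5 + J 6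
  = 720 * jac ci B e1 e2 0 0 s t.
Proof. rewrite /jac /=; ring. Qed.

(* Along the first momentum axis the increments of [(S, T)] are in ratio [1 : - u2]. *)
Lemma jac_top1 (ci B u1 u2 s : K) : u1 != 0 -> u2 != 0 ->
  jac ci B (u1^-1 + u2^-1) (u1^-1 * u2^-1) 0 0 s (- u2 * s)
  = 4 * ci * u2 ^+ 5 * s ^+ 6 * (u1 - u2) / u1 * (u2^-1 - u1^-1) * (2 * u2^-1 + B).
Proof. by move=> u10 u20; rewrite /jac; field; rewrite u10 u20. Qed.

(** If all seven values vanished, so would their sixth difference, which is [6! = 720] times the
    top-degree part in the direction of the line. [jac_top1] factors that part into nonzero
    terms. *)
Lemma jac_line_neq0 (ci B u1 u2 l d S T s : K) :
  ci != 0 -> u1 != 0 -> u2 != 0 -> u1 != u2 -> s != 0 -> 2 * u2^-1 + B != 0 ->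
  exists2 n : nat, (n <= 6)%N &
    jac ci B (u1^-1 + u2^-1) (u1^-1 * u2^-1) l d
      (S + n%:R * s) (T + n%:R * (- u2 * s)) != 0.
Proof.
move=> ci0 u10 u20 u12 s0 B0.
apply: contrapT => H.
have Z n : (n <= 6)%N -> jac ci B (u1^-1 + u2^-1) (u1^-1 * u2^-1) l d
      (S + n%:R * s) (T + n%:R * (- u2 * s)) = 0.
  by move=> n6; apply/eqP/negP => /negP h; apply: H; exists n.
have := jac_difference ci B (u1^-1 + u2^-1) (u1^-1 * u2^-1) l d S T s (- u2 * s).
rewrite /= (Z 0%N) // (Z 1%N) // (Z 2%N) // (Z 3%N) // (Z 4%N) // (Z 5%N) // (Z 6%N) //.
rewrite jac_top1 // !mulr0 !subr0 !addr0 => /esym/eqP; apply/negP.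
have v12 : u2^-1 - u1^-1 != 0 by rewrite subr_eq0 (inj_eq invr_inj) eq_sym.
have d12 : u1 - u2 != 0 by rewrite subr_eq0.
by rewrite !mulf_neq0 ?expf_neq0 ?invr_neq0 ?pnatr_eq0.
Qed.

End Differences.

Section Integrable.
Variable R : realType.
Local Notation C := R[i].
Implicit Types (f g : 'rV[R]_4 -> C) (x : 'rV[R]_4) (w : 'I_4 -> C).

Lemma regular_near x : regular_points x -> \forall y \near x, regular_points y.
Proof.
move=> [x0 x1 x01].
have cc i : {for x, continuous (fun y : 'rV[R]_4 => y 0 i)}.
  exact: differentiable_continuous (differentiable_coord x 0 i).
have n0 : \forall y \near x, (y : 'rV[R]_4) 0 0 != 0 by exact: (cvgr_neq0 _ (cc 0) x0).
have n1 : \forall y \near x, (y : 'rV[R]_4) 0 1 != 0 by exact: (cvgr_neq0 _ (cc 1) x1).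
have x01' : x 0 0 - x 0 1 != 0 by rewrite subr_eq0.
have n01 : \forall y \near x, (y : 'rV[R]_4) 0 0 - y 0 1 != 0.
  exact: (cvgr_neq0 _ (cvgB (cc 0) (cc 1)) x01').
apply: filterS (filterI n0 (filterI n1 n01)) => y [h0 [h1 h01]].
by split=> //; rewrite -subr_eq0.
Qed.

Section Sym.
Variables (a b c : C).
Hypothesis c0 : c != 0.

Definition Hs1 x := Hpol1 a b c (E1f x) (E2f x) (Sf x) (Tf x).
Definition Hs2 x := Hpol2 a b c (E1f x) (E2f x) (Sf x) (Tf x).

Variable x : 'rV[R]_4.
Hypothesis rx : regular_points x.
Let F := frame (@symf R) x.

Lemma dframe_E1f : dframe F (@E1f R) x (fun j => (j == 0)%:R).
Proof. exact: dframe_frame (symf_differentiable rx 0). Qed.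
Lemma dframe_E2f : dframe F (@E2f R) x (fun j => (j == 1)%:R).
Proof. exact: dframe_frame (symf_differentiable rx 1). Qed.
Lemma dframe_Sf : dframe F (@Sf R) x (fun j => (j == 2)%:R).
Proof. exact: dframe_frame (symf_differentiable rx 2). Qed.
Lemma dframe_Tf : dframe F (@Tf R) x (fun j => (j == 3)%:R).
Proof. exact: dframe_frame (symf_differentiable rx 3). Qed.

Let k (z : C) := dframe_cst F z x.
Let dk : dframe F (fun y => kappa a b c (E1f y) (E2f y) (Tf y)) x _ :=
  dframe_add (dframe_add (dframe_add (dframe_exp 2 dframe_Tf) (k a))
    (dframe_mul (k b) dframe_E1f))
    (dframe_mul (k c) (dframe_add (dframe_exp 2 dframe_E1f) (dframe_opp dframe_E2f))).
Let dh1 : dframe F (fun y => ham1 a b c (E1f y) (E2f y) (Sf y) (Tf y)) x _ :=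
  dframe_add (dframe_exp 2 dframe_Sf) (dframe_opp (dframe_mul dframe_E2f dk)).
Let dh2 : dframe F (fun y => ham2 a b c (E1f y) (E2f y) (Sf y) (Tf y)) x _ :=
  dframe_add (dframe_add (dframe_mul (dframe_mul (k 2) dframe_Sf) dframe_Tf)
    (dframe_mul dframe_E1f dk))
    (dframe_opp (dframe_mul dframe_E2f (dframe_add (k b) (dframe_mul (k c) dframe_E1f)))).
Let dH1 : dframe F Hs1 x _ :=
  dframe_add (dframe_mul (k 2) dh1)
    (dframe_opp (dframe_mul (dframe_add (k (b / c)) dframe_E1f) dh2)).
Let dH2 : dframe F Hs2 x _ :=
  dframe_mul (dframe_mul (k (- 4^-1)) (dframe_exp 2 dh2))
    (dframe_add (dframe_exp 2 (dframe_add (k (b / c)) dframe_E1f))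
      (dframe_opp (dframe_mul (k (4 / c)) dk))).

Local Ltac eval_sym := rewrite /sym_br; cbv beta;
  rewrite /ham1 /ham2 /kappa;
  move: (E1f x) (E2f x) (Sf x) (Tf x) => ? ? ? ?; simpl.

Lemma Hs_involution : bracket (@Pi_can R) Hs1 Hs2 x = 0.
Proof. rewrite (bracket_sym rx dH1 dH2); eval_sym; field; exact: c0. Qed.

Definition hconst (e1 e2 : C) :=
  e1 * (a + b * e1 + c * (e1 ^+ 2 - e2)) - e2 * (b + c * e1).
Definition dconst (e1 e2 : C) :=
  (b / c + e1) ^+ 2 - 4 / c * (a + b * e1 + c * (e1 ^+ 2 - e2)).

(** Bracketing with [E1f] and [E2f] sees only the [S] and [T] derivatives: [{f, e1} = f_S] and
    [{f, e2} = e1 f_S - f_T]. The [e1] terms cancel in the minor. *)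
Lemma Hs_minor :
  bracket (@Pi_can R) Hs1 (@E1f R) x * bracket (@Pi_can R) Hs2 (@E2f R) x
  - bracket (@Pi_can R) Hs1 (@E2f R) x * bracket (@Pi_can R) Hs2 (@E1f R) x
  = jac c^-1 (b / c + E1f x) (E1f x) (E2f x) (hconst (E1f x) (E2f x))
      (dconst (E1f x) (E2f x)) (Sf x) (Tf x).
Proof.
rewrite !(bracket_sym rx dH1 dframe_E1f, bracket_sym rx dH1 dframe_E2f,
  bracket_sym rx dH2 dframe_E1f, bracket_sym rx dH2 dframe_E2f).
rewrite /jac /hconst /dconst; eval_sym; field; exact: c0.
Qed.

End Sym.
End Integrable.

Lemma pairing_combl (K : comNzRingType) n (P : 'M[K]_n) (s t : K) (g h k : 'rV[K]_n) :
  ((s *: g + t *: h) *m P *m k^T) 0 0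
  = s * (g *m P *m k^T) 0 0 + t * (h *m P *m k^T) 0 0.
Proof. by rewrite !mulmxDl -!scalemxAl !mxE. Qed.

Lemma cramer2 (K : fieldType) (s t p q p' q' : K) :
  s * p + t * q = 0 -> s * p' + t * q' = 0 -> p * q' - p' * q != 0 -> s = 0 /\ t = 0.
Proof.
move=> h h' d; split; apply: (mulIf d); rewrite mul0r.
  transitivity (q' * (s * p + t * q) - q * (s * p' + t * q')); first by ring.
  by rewrite h h' !mulr0 subr0.
transitivity (p * (s * p' + t * q') - p' * (s * p + t * q)); first by ring.
by rewrite h h' !mulr0 subr0.
Qed.

Lemma rmorph_H1 (K L : fieldType) (f : {rmorphism K -> L}) (a b c u1 u2 p1 p2 : K) :
  f (H1 a b c u1 u2 p1 p2) = H1 (f a) (f b) (f c) (f u1) (f u2) (f p1) (f p2).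
Proof.
by rewrite /H1 !(rmorph_nat, rmorphXn, rmorphD, rmorphN, rmorphM, fmorphV, rmorph1).
Qed.

Lemma rmorph_H2 (K L : fieldType) (f : {rmorphism K -> L}) (a b c u1 u2 p1 p2 : K) :
  f (H2 a b c u1 u2 p1 p2) = H2 (f a) (f b) (f c) (f u1) (f u2) (f p1) (f p2).
Proof.
by rewrite /H2 /Ffac /Gfac !(rmorph_nat, rmorphXn, rmorphD, rmorphN, rmorphM, fmorphV, rmorph1).
Qed.

Section Independence.
Variable R : realType.
Local Notation C := R[i].
Implicit Types (f g : 'rV[R]_4 -> C) (x : 'rV[R]_4).

(** Pairing a linear relation between the two differentials with the test functions [k1], [k2] gives
    a two by two system with nonzero determinant. *)
Lemma row_free_bracket P f g k1 k2 x :
  bracket P f k1 x * bracket P g k2 x - bracket P f k2 x * bracket P g k1 x != 0 ->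
  row_free (col_mx (grad f x) (grad g x)).
Proof.
move=> D0; apply: inj_row_free => v; rewrite -[v]hsubmxK mul_row_col.
set v1 := lsubmx v; set v2 := rsubmx v => vfg.
have E k : v1 0 0 * bracket P f k x + v2 0 0 * bracket P g k x = 0.
  rewrite -pairing_combl -!mul_scalar_mx -!mx11_scalar vfg !mul0mx; exact: mxE.
have [z1 z2] := cramer2 (E k1) (E k2) D0.
have -> : v1 = 0 by apply/rowP => i; rewrite !ord1 z1 mxE.
have -> : v2 = 0 by apply/rowP => i; rewrite !ord1 z2 mxE.
by rewrite row_mx0.
Qed.

Variables a b c : R.
Hypothesis c0 : c != 0.

Lemma complex_neq0 (z : R) : z != 0 -> z%:C != 0 :> C.
Proof. by move=> h; rewrite -(rmorph0 (real_complex R)) (inj_eq (@complexI R)). Qed.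

Lemma Hhat1_sym x : regular_points x -> Hhat1 a b c x = Hs1 a%:C b%:C c%:C x.
Proof.
move=> rx; rewrite /Hhat1 /at_point rmorph_H1.
exact: H1_sym (complex_neq0 c0) (ucoord0_neq0 rx) (ucoord1_neq0 rx) (ucoord01 rx).
Qed.

Lemma Hhat2_sym x : regular_points x -> Hhat2 a b c x = Hs2 a%:C b%:C c%:C x.
Proof.
move=> rx; rewrite /Hhat2 /at_point rmorph_H2.
exact: H2_sym (complex_neq0 c0) (ucoord0_neq0 rx) (ucoord1_neq0 rx) (ucoord01 rx).
Qed.

Lemma grad_Hhat1 x : regular_points x -> grad (Hhat1 a b c) x = grad (Hs1 a%:C b%:C c%:C) x.
Proof. by move=> rx; apply: grad_near; apply: filterS (regular_near rx) => y; exact: Hhat1_sym. Qed.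

Lemma grad_Hhat2 x : regular_points x -> grad (Hhat2 a b c) x = grad (Hs2 a%:C b%:C c%:C) x.
Proof. by move=> rx; apply: grad_near; apply: filterS (regular_near rx) => y; exact: Hhat2_sym. Qed.

Lemma Hhat_involution x : regular_points x ->
  bracket (@Pi_can R) (Hhat1 a b c) (Hhat2 a b c) x = 0.
Proof.
move=> rx; rewrite /bracket grad_Hhat1 // grad_Hhat2 //.
exact: (Hs_involution _ _ (complex_neq0 c0) rx).
Qed.

Definition Hjac x : C :=
  jac (c%:C)^-1 (b%:C / c%:C + E1f x) (E1f x) (E2f x) (hconst a%:C b%:C c%:C (E1f x) (E2f x))
      (dconst a%:C b%:C c%:C (E1f x) (E2f x)) (Sf x) (Tf x).

Lemma row_free_Hhat x : regular_points x -> Hjac x != 0 ->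
  row_free (col_mx (grad (Hhat1 a b c) x) (grad (Hhat2 a b c) x)).
Proof.
move=> rx j0; rewrite grad_Hhat1 // grad_Hhat2 //.
apply: (@row_free_bracket (@Pi_can R) _ _ (@E1f R) (@E2f R)).
by rewrite (Hs_minor _ _ (complex_neq0 c0) rx).
Qed.

Lemma ucoord_line i j x n (t : R) :
  ucoord j (x + (n%:R * t) *: delta_mx 0 i) = ucoord j x + (j == i)%:R * (n%:R * t%:C) :> C.
Proof.
rewrite /ucoord 3!mxE eqxx [_ * _%:R]mulrC rmorphD !rmorphM !rmorph_nat; reflexivity.
Qed.

(** Moving [p1] fails only if [2 / u2 + b / c + e1 = 0], moving [p2] only if
    [2 / u1 + b / c + e1 = 0]. Both cannot hold, as [u1] and [u2] differ. *)
Lemma Hjac_line x (t : R) : regular_points x -> t != 0 ->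
  exists i : 'I_4, [/\ i != 0, i != 1 &
    exists2 n : nat, (n <= 6)%N & Hjac (x + (n%:R * t) *: delta_mx 0 i) != 0].
Proof.
move=> rx t0; have u10 := ucoord0_neq0 rx; have u20 := ucoord1_neq0 rx; have u12 := ucoord01 rx.
have d12 := ucoordB_neq0 rx; have tC0 : t%:C != 0 :> C := complex_neq0 t0.
have ci0 : (c%:C)^-1 != 0 :> C by rewrite invr_neq0 // complex_neq0.
have [B0|B0] := eqVneq (2 * (ucoord 1 x)^-1 + (b%:C / c%:C + E1f x)) 0; last first.
  exists 2; split=> //.
  (* This is the increment of [S] when [p1] grows by [t]; that of [T] is [- u2] times it. *)
  have s0 : ucoord 0 x ^+ 3 * t%:C * (ucoord 0 x - ucoord 1 x)^-1 != 0.
    by rewrite !mulf_neq0 ?invr_neq0 ?expf_neq0.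
  have [n n6 J0] := jac_line_neq0 (hconst a%:C b%:C c%:C (E1f x) (E2f x))
    (dconst a%:C b%:C c%:C (E1f x) (E2f x)) (Sf x) (Tf x) ci0 u10 u20 u12 s0 B0.
  exists n; first exact: n6.
 move: J0.
 congr (_ != 0).
  have e1 : E1f (x + (n%:R * t) *: delta_mx 0 2) = E1f x.
    by rewrite /E1f !ucoord_line /= !mul0r !addr0.
  have e2 : E2f (x + (n%:R * t) *: delta_mx 0 2) = E2f x.
    by rewrite /E2f !ucoord_line /= !mul0r !addr0.
  rewrite /Hjac e1 e2; congr (jac _ _ _ _ _ _ _ _).
    rewrite /Sf /slope !ucoord_line /= !mul0r !addr0 !mul1r.
    move: (ucoord 0 x) (ucoord 1 x) (ucoord 2 x) (ucoord 3 x) (t%:C) u10 u20 d12 => ? ? ? ? ? ? ? h.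
    by field; exact: h.
  rewrite /Tf /icpt !ucoord_line /= !mul0r !addr0 !mul1r.
  move: (ucoord 0 x) (ucoord 1 x) (ucoord 2 x) (ucoord 3 x) (t%:C) u10 u20 d12 => ? ? ? ? ? ? ? h.
  by field; exact: h.
exists 3; split=> //.
have v12 : (ucoord 0 x)^-1 != (ucoord 1 x)^-1 by rewrite (inj_eq invr_inj).
have B1 : 2 * (ucoord 0 x)^-1 + (b%:C / c%:C + E1f x) != 0.
  apply: contra_neq v12 => B1.
  have : 2 * ((ucoord 0 x)^-1 - (ucoord 1 x)^-1) = 0 :> C.
    rewrite mulrBr -[2 * (ucoord 0 x)^-1](addrK (b%:C / c%:C + E1f x)) B1.
    rewrite -[2 * (ucoord 1 x)^-1](addrK (b%:C / c%:C + E1f x)) B0; ring.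
  by move/eqP; rewrite mulf_eq0 pnatr_eq0 /= subr_eq0 => /eqP.
have s0 : - (ucoord 1 x ^+ 3 * t%:C * (ucoord 0 x - ucoord 1 x)^-1) != 0.
  by rewrite oppr_eq0 !mulf_neq0 ?invr_neq0 ?expf_neq0.
have u21 : ucoord 1 x != ucoord 0 x by rewrite eq_sym.
(* Along [p2] the increments are in ratio [1 : - u1], so the lemma is used with [u1] and [u2]
   exchanged; [e1] and [e2] are symmetric, hence the later commutations. *)
have [n n6 J0] := jac_line_neq0 (hconst a%:C b%:C c%:C (E1f x) (E2f x))
  (dconst a%:C b%:C c%:C (E1f x) (E2f x)) (Sf x) (Tf x) ci0 u20 u10 u21 s0 B1.
exists n; first exact: n6.
 move: J0.
 congr (_ != 0).
have e1 : E1f (x + (n%:R * t) *: delta_mx 0 3) = E1f x.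
  by rewrite /E1f !ucoord_line /= !mul0r !addr0.
have e2 : E2f (x + (n%:R * t) *: delta_mx 0 3) = E2f x.
  by rewrite /E2f !ucoord_line /= !mul0r !addr0.
rewrite /Hjac e1 e2 [_^-1 + _]addrC [_^-1 * (_)^-1]mulrC; congr (jac _ _ _ _ _ _ _ _).
  rewrite /Sf /slope !ucoord_line /= !mul0r !addr0 !mul1r.
  move: (ucoord 0 x) (ucoord 1 x) (ucoord 2 x) (ucoord 3 x) (t%:C) u10 u20 d12 => ? ? ? ? ? ? ? h.
  by field; exact: h.
rewrite /Tf /icpt !ucoord_line /= !mul0r !addr0 !mul1r.
move: (ucoord 0 x) (ucoord 1 x) (ucoord 2 x) (ucoord 3 x) (t%:C) u10 u20 d12 => ? ? ? ? ? ? ? h.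
by field; exact: h.
Qed.

Lemma Hhat_integrable : integrable_on (@regular_points R) (Hhat1 a b c) (Hhat2 a b c).
Proof.
split; last exact: Hhat_involution.
move=> x rx B /nbhs_ballP[r /= r0 rB].
(* At most six steps of length [t] are taken, so the point reached stays within distance [r]. *)
pose t := r / 7.
have t0 : 0 < t by rewrite divr_gt0.
have [i [i0 i1 [n n6 J0]]] := Hjac_line rx (lt0r_neq0 t0).
set y := x + (n%:R * t) *: delta_mx 0 i in J0.
have ry : regular_points y.
  (* Only a momentum moves, and regularity constrains the positions alone. *)
  have yj (j : 'I_4) : j != i -> y 0 j = x 0 j.
    by move=> ji; rewrite 3!mxE (negPf ji) andbF mulr0 addr0.
  by case: rx => h0 h1 h01; split; rewrite ?yj // eq_sym.
exists y; split; first by split=> //; exact: row_free_Hhat.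
apply: rB; rewrite -ball_normE /= opprD addrA subrr sub0r normrN normrZ.
have nd : `|delta_mx 0 i : 'rV[R]_4| <= 1.
  (* The sup norm is either zero or attained at an entry, and the entries are [0] or [1]. *)
  rewrite -[`|_|]/(mx_norm _).
  have [->//|/mx_norm_neq0[k ->]] := eqVneq (mx_norm (delta_mx 0 i : 'rV[R]_4)) 0.
  by rewrite mxE normr_nat; case: (_ && _).
have nt0 : 0 <= n%:R * t by rewrite mulr_ge0 ?ler0n //; exact: ltW.
rewrite (ger0_norm nt0); apply: le_lt_trans (ler_piMr nt0 nd) _.
by rewrite /t mulrA ltr_pdivrMr // mulrC ltr_pM2l // ltr_nat.
Qed.

End Independence.

(** * Degree in the momenta *)

Section Degree.
(* The notations of [mpoly] clash with those of MathComp-Analysis. *)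
Import -(notations) mpoly.
Variable R : fieldType.
Local Notation P := (mpoly.mpoly 2 R).
Local Notation X i := (mpoly.mpolyX R (mpoly.mnm1 (i : 'I_2))).
Implicit Types p q : P.

(** [msize] is one more than the degree and is [0] for the zero polynomial, so the predecessor is
    right in both cases. *)
Lemma total_degreeE p : total_degree p = (mpoly.msize p).-1.
Proof.
rewrite /total_degree mpoly.msizeE; elim: (mpoly.msupp p) => [|m r IH].
  by rewrite !big_nil.
rewrite !big_cons IH; case: (\max_(_ <- _) _)%N => [|k] /=; last by rewrite maxnSS.
by rewrite maxn0.
Qed.

Lemma msize_addl p q : (mpoly.msize q < mpoly.msize p)%N ->
  mpoly.msize (p + q) = mpoly.msize p.
Proof.
move=> qp; apply/eqP; rewrite eqn_leq; apply/andP; split.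
  by apply: leq_trans (mpoly.msizeD_le _ _) _; rewrite geq_max leqnn ltnW.
have := mpoly.msizeD_le (p + q) (- q); rewrite addrK mpoly.msizeN leq_max.
by rewrite [(_ <= mpoly.msize q)%N]leqNgt qp orbF.
Qed.

Lemma msize_addC p (k : R) : (1 < mpoly.msize p)%N ->
  mpoly.msize (p + mpoly.mpolyC 2 k) = mpoly.msize p.
Proof.
move=> p1; apply: msize_addl; rewrite mpoly.msizeC.
by apply: leq_ltn_trans p1; case: (k != 0).
Qed.

Lemma msize_mul p q : (0 < mpoly.msize p)%N -> (0 < mpoly.msize q)%N ->
  mpoly.msize (p * q) = (mpoly.msize p + mpoly.msize q).-1.
Proof.
move=> p0 q0; apply: mpoly.msizeM; rewrite -mpoly.msize_poly_eq0 -lt0n //.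
Qed.

Lemma msize_linear (k l : R) : k != 0 -> mpoly.msize (k *: X 0 + l *: X 1 : P) = 2%N.
Proof.
move=> k0; apply/eqP; rewrite eqn_leq; apply/andP; split.
  apply: leq_trans (mpoly.msizeD_le _ _) _; rewrite geq_max.
  by rewrite !(leq_trans (mpoly.msizeZ_le _ _)) // mpoly.msizeX mpoly.mdeg1.
have : mpoly.mnm1 (0 : 'I_2) \in mpoly.msupp (k *: X 0 + l *: X 1 : P).
  rewrite mpoly.mcoeff_msupp mpoly.mcoeffD !mpoly.mcoeffZ !mpoly.mcoeffXU.
  by rewrite mulr1 mulr0 addr0.
by move/mpoly.msize_mdeg_lt; rewrite mpoly.mdeg1.
Qed.

Lemma H2_polynomial (a b c u1 u2 : R) : c != 0 -> u1 != 0 -> u2 != 0 -> u1 != u2 ->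
  exists q : P, total_degree q = 6%N
    /\ forall p : 'I_2 -> R, H2 a b c u1 u2 (p 0) (p 1) = mpoly.meval p q.
Proof.
move=> c0 u10 u20 u12; have d0 : u1 - u2 != 0 by rewrite subr_eq0.
(* The quadratic part of [F] is proportional to [L^2] and that of [G] to [L L']; neither has a
   linear part, so the rest is the value at zero momenta. Degrees add over a field:
   [2 + 2 * 2 = 6]. *)
pose L : P := u1 ^+ 2 *: X 0 + (- u2 ^+ 2) *: X 1.
pose L' : P := u1 ^+ 2 *: X 0 + u2 ^+ 2 *: X 1.
pose kF := c * u1 ^+ 4 * u2 ^+ 4.
pose kG := (c * (u1 - u2) ^+ 2)^-1.
pose F : P := kF *: (L * L) + mpoly.mpolyC 2 (Ffac a b c u1 u2 0 0).
pose G : P := kG *: (L * L') + mpoly.mpolyC 2 (Gfac a b c u1 u2 0 0).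
have kF0 : kF != 0 by rewrite !mulf_neq0 ?expf_neq0.
have kG0 : kG != 0 by rewrite invr_neq0 // mulf_neq0 ?expf_neq0.
have sL : mpoly.msize L = 2%N by rewrite msize_linear ?expf_neq0.
have sL' : mpoly.msize L' = 2%N by rewrite msize_linear ?expf_neq0.
have sF : mpoly.msize F = 3%N by rewrite msize_addC mpoly.msizeZ ?msize_mul ?sL.
have sG : mpoly.msize G = 3%N by rewrite msize_addC mpoly.msizeZ ?msize_mul ?sL ?sL'.
exists (F * (G * G)); split.
  by rewrite total_degreeE !msize_mul ?sF ?sG.
move=> p.
rewrite !mpoly.mevalM !mpoly.mevalD !mpoly.mevalC !mpoly.mevalZ !mpoly.mevalM.
rewrite !mpoly.mevalD !mpoly.mevalZ !mpoly.mevalXU /H2 expr2.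
congr (_ * (_ * _)).
- rewrite /Ffac /kF; ring.
- by rewrite /Gfac /kG; field; rewrite ?c0 ?d0 ?u10 ?u20.
- by rewrite /Gfac /kG; field; rewrite ?c0 ?d0 ?u10 ?u20.
Qed.

End Degree.

(** * The branches as canonical coordinates *)

Section LinearAlgebra.
Variable K : numFieldType.

Lemma sum_comb4 (s d t : K) (F : 'I_4 -> K) :
  \sum_i (s * (i == 0)%:R - d * (i == 1)%:R + t * (i == 3)%:R) * F i
  = s * F 0 - d * F 1 + t * F 3.
Proof. rewrite sum4 /=; ring. Qed.

Lemma sum_combr (q s t : K) (F : 'I_4 -> K) :
  \sum_i (q * (s * (i == 0)%:R + (i == 1)%:R - t * (i == 3)%:R)) * F i
  = q * (s * F 0 + F 1 - t * F 3).
Proof. rewrite sum4 /=; ring. Qed.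

(** The long hypothesis keeps the literal shape produced by the [dframe] rules, zero differentials
    of constants included. Solving the sum of the roots for [b] makes [f - r] appear as the
    coefficient of [pf]. *)
Lemma implicit_slope (b d e1 f r pf T F0 F1 F3 : K) : d != 0 ->
  r = - (b / d + e1) - f -> f - r != 0 ->
  f * (- (b / d + e1) - f) * 0
    + d * ((- (b / d + e1) - f) * pf + f * (- (0 + F0) - pf))
    = (b + 2 * d * e1) * F0 - d * F1 + 2 * T * F3 ->
  pf = (f - r)^-1 * ((r - e1) * F0 + F1 - 2 * T / d * F3).
Proof.
move=> d0 rE fr; rewrite -rE => E; apply: (mulfI fr); rewrite mulrA divff // mul1r.
apply: (mulfI d0); apply/eqP; rewrite -subr_eq0; apply/eqP.
have bE : b = - d * (r + f + e1) by rewrite rE; field.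
transitivity ((b + 2 * d * e1) * F0 - d * F1 + 2 * T * F3
  - (f * r * 0 + d * (r * pf + f * (- (0 + F0) - pf)))); last by rewrite E subrr.
by rewrite bE; field.
Qed.

End LinearAlgebra.

Section Branches.
Variable R : realType.
Local Notation C := R[i].
Implicit Types (f g : 'rV[R]_4 -> C) (x : 'rV[R]_4) (w : 'I_4 -> C).

Lemma dframe1 f x : differentiableC f x -> dframe 1%:M f x (fun j => pd j f x).
Proof. by move=> df; split=> //; rewrite mulmx1. Qed.

Lemma dframe1E f x w j : dframe 1%:M f x w -> pd j f x = w j.
Proof. by move=> [_]; rewrite mulmx1 => /rowP/(_ j); rewrite !mxE. Qed.

Lemma dframe_pd E f x w j : dframe E f x w -> pd j f x = \sum_i w i * E i j.
Proof.
move=> [_] /rowP/(_ j); rewrite !mxE => ->; apply: eq_bigr => i _; by rewrite mxE.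
Qed.

Variables a b c : R.
Hypothesis c0 : c != 0.
Variables (U : set 'rV[R]_4) (uh : 'I_2 -> 'rV[R]_4 -> C).
Hypothesis gb : generic_branches a b c U uh.
Local Notation A := (a%:C : C).
Local Notation B := (b%:C : C).
Local Notation D := (c%:C : C).

Lemma branches_open : open U. Proof. by case: gb => [[]]. Qed.
Lemma branches_regular x : U x -> regular_points x. Proof. by case: gb => [[_ h]] _ _ _ _; exact: h. Qed.
Lemma branches_near x : U x -> \forall y \near x, U y.
Proof. by move=> Ux; exact: open_nbhs_nbhs (conj branches_open Ux). Qed.
Let D_neq0 : D != 0. Proof. exact: complex_neq0. Qed.

Definition ybranch (i : 'I_2) x : C := (uh i x)^-1.
Definition kappaf x : C := kappa A B D (E1f x) (E2f x) (Tf x).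

Lemma branch_root i x : U x ->
  kappaf x * uh i x ^+ 2 + (B + D * E1f x) * uh i x + D = 0.
Proof.
move=> Ux; have rx := branches_regular Ux.
have : at_pointC (quad A B D) x (uh i x) = 0.
  case: gb => _ _ rt _ _; apply/(rt x Ux).
  by case: i => [[|[|]]] // h; [left|right]; congr (uh _ x); exact: val_inj.
rewrite /at_pointC (quad_sym _ _ _ _ _ (ucoord0_neq0 rx) (ucoord1_neq0 rx) (ucoord01 rx)).
move/eqP; rewrite mulf_eq0 oppr_eq0 /prodV mulf_eq0 !invr_eq0.
by rewrite (negPf (ucoord0_neq0 rx)) (negPf (ucoord1_neq0 rx)) => /eqP.
Qed.

Lemma branch_vieta x : U x ->
  [/\ uh 0 x != 0, uh 1 x != 0, ybranch 0 x + ybranch 1 x = - (B / D + E1f x)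
    & D * (ybranch 0 x * ybranch 1 x) = kappaf x].
Proof.
move=> Ux; have n01 : uh 0 x != uh 1 x by case: gb => _ _ _ h _; exact: h.
exact: vieta_inv D_neq0 n01 (branch_root 0 Ux) (branch_root 1 Ux).
Qed.

Lemma uh_neq0 i x : U x -> uh i x != 0.
Proof.
move=> /branch_vieta[h0 h1 _ _].
by case: i => [[|[|]]] // h; [move: h0|move: h1]; congr (uh _ x != 0); exact: val_inj.
Qed.

Lemma ybranch_neq0 i x : U x -> ybranch i x != 0.
Proof. by move=> Ux; rewrite invr_neq0 // uh_neq0. Qed.

Lemma ybranch01 x : U x -> ybranch 0 x - ybranch 1 x != 0.
Proof.
move=> Ux; rewrite subr_eq0 (inj_eq invr_inj).
by case: gb => _ _ _ h _; exact: h.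
Qed.

Lemma phatE i x : U x ->
  phat uh i x = - (ybranch i x ^+ 2 * (Sf x + Tf x * ybranch i x)).
Proof.
move=> Ux; have rx := branches_regular Ux; have := uh_neq0 i Ux.
rewrite /phat /at_pointC (Qpol_sym _ _ (ucoord01 rx)) -/(Sf x) -/(Tf x) /ybranch.
move: (uh i x) (Sf x) (Tf x) => z S T z0.
by field; exact: z0.
Qed.

Lemma lamE i x : U x ->
  lam a b c uh i x = (ham1 A B D (E1f x) (E2f x) (Sf x) (Tf x)
    + ham2 A B D (E1f x) (E2f x) (Sf x) (Tf x) * ybranch i x) / 2.
Proof.
move=> Ux; rewrite /lam phatE // -[X in lambda _ _ _ X]invrK.
apply: lambda_root (ybranch_neq0 i Ux) _.
have := branch_root i Ux; have := uh_neq0 i Ux; rewrite -/(kappaf x) /ybranch.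
move: (uh i x) (kappaf x) => z k z0 h.
transitivity (z ^- 2 * (k * z ^+ 2 + (B + D * E1f x) * z + D)); last by rewrite h mulr0.
by field; exact: z0.
Qed.

Lemma Hhat_lam x : U x ->
  Hhat1 a b c x = 2 * (lam a b c uh 0 x + lam a b c uh 1 x)
  /\ Hhat2 a b c x = - (lam a b c uh 0 x - lam a b c uh 1 x) ^+ 2.
Proof.
move=> Ux; have rx := branches_regular Ux; have [_ _ s p] := branch_vieta Ux.
rewrite (Hhat1_sym _ _ c0 rx) (Hhat2_sym _ _ c0 rx).
exact: Hpol_roots D_neq0 s p (lamE 0 Ux) (lamE 1 Ux).
Qed.

Section At.
Variable x : 'rV[R]_4.
Hypothesis Ux : U x.
Let rx := branches_regular Ux.
Let F := frame (@symf R) x.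
Let k (z : C) := dframe_cst F z x.

Lemma dframe_kappaf : dframe F kappaf x
  (fun j => (B + 2 * D * E1f x) * (j == 0)%:R - D * (j == 1)%:R + 2 * Tf x * (j == 3)%:R).
Proof.
have H := dframe_add (dframe_add (dframe_add (dframe_exp 2 (dframe_Tf rx)) (k A))
    (dframe_mul (k B) (dframe_E1f rx)))
    (dframe_mul (k D) (dframe_add (dframe_exp 2 (dframe_E1f rx)) (dframe_opp (dframe_E2f rx)))).
apply: dframe_eq H => j /=; rewrite !expr1; ring.
Qed.

(* Implicit differentiation of the quadratic, [r] being the other root. *)
Lemma dframe_root f (r : C) : differentiableC f x ->
  (forall y, U y -> D * (f y * (- (B / D + E1f y) - f y)) = kappaf y) ->
  r = - (B / D + E1f x) - f x -> f x - r != 0 ->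
  dframe F f x (fun j => (f x - r)^-1 *
    ((r - E1f x) * (j == 0)%:R + (j == 1)%:R - 2 * Tf x / D * (j == 3)%:R)).
Proof.
move=> df rel rE d0; split=> //.
(* The relation is differentiated in the standard frame, because the coefficients of [f] on [F] are
   what is sought. *)
have H := dframe_mul (dframe_cst 1%:M D x) (dframe_mul (dframe1 df)
  (dframe_add (dframe_opp (dframe_add (dframe_cst 1%:M (B / D) x)
     (dframe1 (symf_differentiable rx 0)))) (dframe_opp (dframe1 df)))).
have nr : {near x, (fun y => D * (f y * (- (B / D + E1f y) - f y))) =1 kappaf}.
  by apply: filterS (branches_near Ux) => y; exact: rel.
have E j := dframe1E j (dframe_near nr H).
have Dn := D_neq0.
apply/rowP => j; rewrite [LHS]mxE; move: (E j).
have -> : pd j kappaf x = (B + 2 * D * E1f x) * F 0 j - D * F 1 j + 2 * Tf x * F 3 j.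
  by rewrite (dframe_pd j dframe_kappaf) sum_comb4.
have -> : (\row_i ((f x - r)^-1 * ((r - E1f x) * (i == 0)%:R + (i == 1)%:R
   - 2 * Tf x / D * (i == 3)%:R)) *m F) 0 j
   = (f x - r)^-1 * ((r - E1f x) * F 0 j + F 1 j - 2 * Tf x / D * F 3 j).
  rewrite -(sum_combr _ _ _ (fun i => F i j)) mxE; apply: eq_bigr => i _; by rewrite mxE.
have -> : F 0 j = pd j (symf 0) x by rewrite /F 2!mxE.
move=> /esym Ej; exact: (implicit_slope D_neq0 rE d0 Ej).
Qed.

Lemma differentiable_uh i : differentiableC (uh i) x.
Proof. by case: gb => _ su _ _ _; exact: smooth_differentiable (su i) Ux. Qed.

Lemma differentiable_ybranch i : differentiableC (ybranch i) x.
Proof. exact: differentiableC_inv (differentiable_uh i) (uh_neq0 i Ux). Qed.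

Lemma dframe_ybranch0 : dframe F (ybranch 0) x (fun j => (ybranch 0 x - ybranch 1 x)^-1 *
    ((ybranch 1 x - E1f x) * (j == 0)%:R + (j == 1)%:R - 2 * Tf x / D * (j == 3)%:R)).
Proof.
apply: dframe_root (differentiable_ybranch 0) _ _ (ybranch01 Ux).
  by move=> y /branch_vieta[_ _ <- <-]; rewrite [ybranch 0 y + _]addrC addrK.
by have [_ _ <- _] := branch_vieta Ux; rewrite [ybranch 0 x + _]addrC addrK.
Qed.

Lemma dframe_ybranch1 : dframe F (ybranch 1) x (fun j => (ybranch 1 x - ybranch 0 x)^-1 *
    ((ybranch 0 x - E1f x) * (j == 0)%:R + (j == 1)%:R - 2 * Tf x / D * (j == 3)%:R)).
Proof.
have d0 : ybranch 1 x - ybranch 0 x != 0 by rewrite -oppr_eq0 opprB ybranch01.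
apply: dframe_root (differentiable_ybranch 1) _ _ d0.
  by move=> y /branch_vieta[_ _ <- <-]; rewrite addrK [ybranch 1 y * _]mulrC.
by have [_ _ <- _] := branch_vieta Ux; rewrite addrK.
Qed.

Lemma dframe_uh E i w : dframe E (ybranch i) x w ->
  dframe E (uh i) x (fun j => - (ybranch i x) ^- 2 * w j).
Proof.
move=> H; have := dframe_inv (ybranch_neq0 i Ux) H; congr (dframe _ _ _ _).
by apply/funext => y; rewrite invrK.
Qed.

Lemma dframe_phat i w : dframe F (ybranch i) x w ->
  dframe F (phat uh i) x (fun j =>
    - ((2 * ybranch i x * (Sf x + Tf x * ybranch i x) + ybranch i x ^+ 2 * Tf x) * w j
       + ybranch i x ^+ 2 * (j == 2)%:R + ybranch i x ^+ 3 * (j == 3)%:R)).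
Proof.
move=> H; have H' := dframe_opp (dframe_mul (dframe_exp 2 H)
  (dframe_add (dframe_Sf rx) (dframe_mul (dframe_Tf rx) H))).
apply: (dframe_near _ (dframe_eq _ H')); last by move=> j /=; ring.
by apply: filterS (branches_near Ux) => y Uy; rewrite phatE.
Qed.

Let br := bracket (@Pi_can R).

(** The differentials of the branches have been written through the other root, without [a] or [b].
    The brackets thus become rational identities in which both roots, [e1], [S], [T] and [c] are
    independent variables. *)
Local Ltac eval_can := rewrite /br; cbv beta;
  have := ybranch_neq0 0 Ux; have := ybranch_neq0 1 Ux; have := ybranch01 Ux; have := D_neq0;
  rewrite /sym_br; cbv beta;
  have : ybranch 1 x - ybranch 0 x != 0 by [rewrite -oppr_eq0 opprB ybranch01];
  move: (ybranch 0 x) (ybranch 1 x) (E1f x) (Sf x) (Tf x) D => ? ? ? ? ? ? ? ? ? ? ?; simpl;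
  field; repeat (apply/andP; split); assumption.

Lemma canonical_qq : br (uh 0) (uh 1) x = 0.
Proof. rewrite /br (bracket_sym rx (dframe_uh dframe_ybranch0) (dframe_uh dframe_ybranch1)); eval_can. Qed.

Lemma canonical_pp : br (phat uh 0) (phat uh 1) x = 0.
Proof. rewrite /br (bracket_sym rx (dframe_phat dframe_ybranch0) (dframe_phat dframe_ybranch1)); eval_can. Qed.

Lemma canonical_q0p0 : br (uh 0) (phat uh 0) x = 1.
Proof. rewrite /br (bracket_sym rx (dframe_uh dframe_ybranch0) (dframe_phat dframe_ybranch0)); eval_can. Qed.

Lemma canonical_q0p1 : br (uh 0) (phat uh 1) x = 0.
Proof. rewrite /br (bracket_sym rx (dframe_uh dframe_ybranch0) (dframe_phat dframe_ybranch1)); eval_can. Qed.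

Lemma canonical_q1p0 : br (uh 1) (phat uh 0) x = 0.
Proof. rewrite /br (bracket_sym rx (dframe_uh dframe_ybranch1) (dframe_phat dframe_ybranch0)); eval_can. Qed.

Lemma canonical_q1p1 : br (uh 1) (phat uh 1) x = 1.
Proof. rewrite /br (bracket_sym rx (dframe_uh dframe_ybranch1) (dframe_phat dframe_ybranch1)); eval_can. Qed.

End At.
End Branches.

(** * Transport of the Jacobi identity *)

Section Trivector.
Variables (K : comNzRingType) (n : nat).
Variables (M P : 'I_n -> 'I_n -> K) (dP S : 'I_n -> 'I_n -> 'I_n -> K).
Hypothesis Panti : forall j k, P k j = - P j k.
Hypothesis Ssym : forall b l j, S b l j = S b j l.

(** The product-rule expansion of [{f_a, {f_b, f_c}}], where [M a i] stands for the [i]-th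
    derivative of [f_a], [S b l j] for a second derivative of [f_b] and [dP l j k] for the [l]-th
    derivative of [P j k]. *)
Definition iterated_bracket a b c := \sum_i \sum_l M a i * P i l *
  (\sum_j \sum_k (S b l j * P j k * M c k + M b j * dP l j k * M c k
                  + M b j * P j k * S c l k)).

Let v a l := \sum_i M a i * P i l.
(** The Hessian of [f_b] evaluated on the vectors [v a] and [v c]; [Kt] below collects the terms
    with derivatives of [P]. *)
Let T a b c := \sum_l \sum_j v a l * S b l j * v c j.
Let Kt a b c := \sum_i \sum_j \sum_k \sum_l M a i * M b j * M c k * (P i l * dP l j k).

Let T_sym a b c : T a b c = T c b a.
Proof.
rewrite /T exchange_big /=; apply: eq_bigr => j _; apply: eq_bigr => l _.
by rewrite Ssym -mulrA mulrC [S b j l * _]mulrC.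
Qed.

Let iterated_bracketE a b c : iterated_bracket a b c = Kt a b c - T a b c + T a c b.
Proof.
have -> : iterated_bracket a b c = \sum_i \sum_l \sum_j \sum_k
      (M a i * M b j * M c k * (P i l * dP l j k))
    + \sum_i \sum_l \sum_j \sum_k (M a i * P i l * S b l j * (P j k * M c k))
    + \sum_i \sum_l \sum_j \sum_k (M a i * P i l * S c l k * (M b j * P j k)).
  rewrite -!big_split; apply: eq_bigr => i _ /=; rewrite -!big_split; apply: eq_bigr => l _ /=.
  rewrite mulr_sumr -!big_split; apply: eq_bigr => j _ /=.
  rewrite mulr_sumr -!big_split; apply: eq_bigr => k _ /=; ring.
congr (_ + _ + _).
- apply: eq_bigr => i _; rewrite exchange_big; apply: eq_bigr => j _ /=.
  by rewrite exchange_big.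
- rewrite /T -sumrN exchange_big; apply: eq_bigr => l _ /=.
  rewrite -sumrN exchange_big; apply: eq_bigr => j _ /=.
  rewrite -!mulrA mulr_suml; rewrite -sumrN; apply: eq_bigr => i _.
  rewrite -mulr_sumr [in RHS]mulrA -mulrN; congr (_ * _).
  by rewrite /v -sumrN; apply: eq_bigr => k _; rewrite Panti mulNr mulrC.
rewrite /T exchange_big; apply: eq_bigr => l _ /=.
under eq_bigr do rewrite exchange_big /=.
rewrite exchange_big; apply: eq_bigr => k _ /=.
rewrite -!mulrA mulr_suml; apply: eq_bigr => i _.
by rewrite -!mulr_sumr -mulrA.
Qed.

(** The cyclic sum contains six Hessian terms; they cancel in pairs by [T_sym], leaving the Schouten
    trivector contracted with three differentials. *)
Lemma iterated_bracket_cyclic a b c : iterated_bracket a b c + iterated_bracket b c a + iterated_bracket c a b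
  = \sum_i M a i * (\sum_j M b j * (\sum_k M c k *
      (\sum_l (P i l * dP l j k + P j l * dP l k i + P k l * dP l i j)))).
Proof.
rewrite !iterated_bracketE (T_sym a b c) (T_sym a c b) (T_sym b a c).
have -> : Kt a b c - T c b a + T b c a + (Kt b c a - T b c a + T c a b)
    + (Kt c a b - T c a b + T c b a) = Kt a b c + Kt b c a + Kt c a b by ring.
have -> : Kt b c a = \sum_i \sum_j \sum_k \sum_l M a i * M b j * M c k * (P j l * dP l k i).
  rewrite /Kt; under eq_bigr do rewrite exchange_big /=.
  rewrite exchange_big; apply: eq_bigr => i _ /=; apply: eq_bigr => j _; apply: eq_bigr => k _.
  by apply: eq_bigr => l _; ring.
have -> : Kt c a b = \sum_i \sum_j \sum_k \sum_l M a i * M b j * M c k * (P k l * dP l i j).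
  rewrite /Kt exchange_big; apply: eq_bigr => i _ /=; rewrite exchange_big.
  apply: eq_bigr => j _ /=; apply: eq_bigr => k _.
  by apply: eq_bigr => l _; ring.
rewrite -!big_split; apply: eq_bigr => i _ /=; rewrite -!big_split mulr_sumr.
apply: eq_bigr => j _ /=; rewrite -!big_split mulrA mulr_sumr.
apply: eq_bigr => k _ /=; rewrite -!big_split mulrA mulr_sumr.
by apply: eq_bigr => l _ /=; ring.
Qed.

End Trivector.

Lemma unitmx_sum_eq0 (K : comUnitRingType) n (A : 'M[K]_n) (g : 'I_n -> K) :
  A \in unitmx -> (forall a, \sum_i A a i * g i = 0) -> forall i, g i = 0.
Proof.
move=> uA Ag i; pose gc : 'cV[K]_n := \col_i g i.
have : A *m gc = 0.
  apply/colP => a; rewrite !mxE -[RHS](Ag a); apply: eq_bigr => k _; by rewrite mxE.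
by move/(congr1 (mulmx (invmx A))); rewrite mulKmx // mulmx0 => /colP/(_ i); rewrite !mxE.
Qed.

Lemma triple_product_rule (K : comNzRingType) (m p q m' p' q' : K) :
  q * (p * m' + m * p') + m * p * q' = m' * p * q + m * p' * q + m * p * q'.
Proof. ring. Qed.

Section Jacobi.
Variable R : realType.
Local Notation C := R[i].
Implicit Types (f g : 'rV[R]_4 -> C) (x : 'rV[R]_4).
Variables (U : set 'rV[R]_4) (fs : 'I_4 -> 'rV[R]_4 -> C) (P : 'rV[R]_4 -> 'M[C]_4).
Hypothesis oU : open U.
Hypothesis sfs : forall i, smooth_on U (fs i).
Hypothesis sP : forall i j, smooth_on U (fun x => P x i j).
Hypothesis aP : forall x, U x -> (P x)^T = - P x.

Lemma differentiableC_sum (I : Type) (r : seq I) (F : I -> 'rV[R]_4 -> C) x :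
  (forall i, differentiableC (F i) x) -> differentiableC (fun y => \sum_(i <- r) F i y) x.
Proof.
move=> dF; elim: r => [|i r IH].
  by apply: differentiableC_near (differentiableC_cst 0 x); near=> y; rewrite big_nil.
apply: differentiableC_near (differentiableC_add (dF i) IH).
by near=> y; rewrite big_cons.
Unshelve. all: by end_near. Qed.

Lemma pd_sum (I : Type) (r : seq I) (F : I -> 'rV[R]_4 -> C) l x :
  (forall i, differentiableC (F i) x) ->
  pd l (fun y => \sum_(i <- r) F i y) x = \sum_(i <- r) pd l (F i) x.
Proof.
move=> dF; elim: r => [|i r IH].
  by rewrite big_nil -[RHS](pd_cst l 0 x); apply: pd_near; near=> y; rewrite big_nil.
rewrite big_cons -IH -(pd_add l (dF i) (differentiableC_sum r dF)).
by apply: pd_near; near=> y; rewrite big_cons.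
Unshelve. all: by end_near. Qed.

Lemma bracketE Q f g x : bracket Q f g x = \sum_i \sum_j pd i f x * Q x i j * pd j g x.
Proof.
rewrite /bracket mxE exchange_big; apply: eq_bigr => j _ /=.
rewrite 2!mxE mulr_suml; apply: eq_bigr => i _; by rewrite !mxE.
Qed.

(** The Jacobi sum is a tensor, so its components vanish once its contractions with four independent
    differentials do. *)
Lemma jacobi_frame x : U x -> frame fs x \in unitmx ->
  (forall a b c, bracket P (fs a) (fun y => bracket P (fs b) (fs c) y) x
    + bracket P (fs b) (fun y => bracket P (fs c) (fs a) y) x
    + bracket P (fs c) (fun y => bracket P (fs a) (fs b) y) x = 0) ->
  forall i j k : 'I_4,
    \sum_l (P x i l * pd l (fun y => P y j k) x
            + P x j l * pd l (fun y => P y k i) x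
            + P x k l * pd l (fun y => P y i j) x) = 0.
Proof.
move=> Ux uM H.
have dfs l j b : differentiableC (fs b) x /\ differentiableC (pd j (fs b)) x
    /\ pd l (pd j (fs b)) x = pd j (pd l (fs b)) x.
  split; first exact: smooth_differentiable (sfs b) Ux.
  split; first exact: smooth_differentiable (smooth_pd j (sfs b)) Ux.
  exact: pd_comm oU Ux (sfs b).
have dPx j k : differentiableC (fun y => P y j k) x by exact: smooth_differentiable (sP j k) Ux.
have E a b c : bracket P (fs a) (fun y => bracket P (fs b) (fs c) y) x
   = iterated_bracket (fun a i => pd i (fs a) x) (P x) (fun l j k => pd l (fun y => P y j k) x)
       (fun b l j => pd l (pd j (fs b)) x) a b c.
  rewrite bracketE /iterated_bracket; apply: eq_bigr => i _; apply: eq_bigr => l _; congr (_ * _).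
  have -> : (fun y => bracket P (fs b) (fs c) y)
      = (fun y => \sum_j \sum_k pd j (fs b) y * P y j k * pd k (fs c) y).
    by apply/funext => y; rewrite bracketE.
  have d3 j k : differentiableC (fun y => pd j (fs b) y * P y j k * pd k (fs c) y) x.
    apply: differentiableC_mul; last by have [_ []] := dfs l k c.
    by apply: differentiableC_mul (dPx j k); have [_ []] := dfs l j b.
  rewrite pd_sum; last by move=> j; exact: differentiableC_sum.
  apply: eq_bigr => j _; rewrite pd_sum //; apply: eq_bigr => k _.
  have [_ [d1 _]] := dfs l j b; have [_ [d2 _]] := dfs l k c.
  rewrite (pd_mul l (differentiableC_mul d1 (dPx j k)) d2) (pd_mul l d1 (dPx j k)).
  exact: triple_product_rule.
have anti j k : P x k j = - P x j k.
  by have /matrixP/(_ j k) := aP Ux; rewrite !mxE.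
have Z a b c : \sum_i pd i (fs a) x * (\sum_j pd j (fs b) x * (\sum_k pd k (fs c) x *
      (\sum_l (P x i l * pd l (fun y => P y j k) x
            + P x j l * pd l (fun y => P y k i) x
            + P x k l * pd l (fun y => P y i j) x)))) = 0.
  have sym b' l j : pd l (pd j (fs b')) x = pd j (pd l (fs b')) x.
    by have [_ [_ ->]] := dfs l j b'.
  have h := H a b c; rewrite (E a b c) (E b c a) (E c a b) in h.
  have h' := iterated_bracket_cyclic (fun a i => pd i (fs a) x)
    (fun l j k => pd l (fun y => P y j k) x) anti sym a b c.
  exact: etrans (esym h') h.
(* Invertibility of the frame strips one contraction at a time; it is used three times. *)
have I (g : 'I_4 -> C) : (forall a, \sum_i pd i (fs a) x * g i = 0) -> forall i, g i = 0.
  move=> Hg; apply: (unitmx_sum_eq0 uM) => a; rewrite -[RHS](Hg a).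
  by apply: eq_bigr => i _; rewrite 2!mxE.
move=> i j k.
have Z1 b c := I _ (fun a => Z a b c) i.
have Z2 c := I _ (fun b => Z1 b c) j.
exact: (I _ Z2 k).
Qed.

End Jacobi.

(** * The second bracket *)

Section Darboux.
Variable K : numFieldType.
Implicit Types (e : bool -> K) (w : 'I_4 -> K).

Definition symp (i j : 'I_4) : K := (j == i + 2 :> nat)%N%:R - (i == j + 2 :> nat)%N%:R.

(* The pairs of conjugate coordinates are (0, 2) and (1, 3), told apart by parity. *)
Definition darboux_mx e : 'M[K]_4 := \matrix_(i, j) (symp i j * e (odd i)).

Definition on_pair (i : bool) w := forall k : 'I_4, odd k != i -> w k = 0.

Lemma symp_parity (i j : 'I_4) : odd i != odd j -> symp i j = 0.
Proof.
move=> h; rewrite /symp.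
have [E|_] := eqVneq (j : nat) (i + 2)%N; first by rewrite E addn2 /= negbK eqxx in h.
have [E|_] := eqVneq (i : nat) (j + 2)%N; first by rewrite E addn2 /= negbK eqxx in h.
by rewrite subrr.
Qed.

Lemma darboux_mx_comb (s t : K) e e' : s *: darboux_mx e + t *: darboux_mx e' = darboux_mx (fun i => s * e i + t * e' i).
Proof. by apply/matrixP => i j; rewrite !mxE; ring. Qed.

Lemma darboux_mx1_sqr : darboux_mx (fun=> 1) *m darboux_mx (fun=> 1) = - 1%:M.
Proof.
apply/matrixP => i j; rewrite mxE sum4 !mxE !mulr1 /symp -val_eqE.
case: i => [[|[|[|[|]]]]] // ?; case: j => [[|[|[|[|]]]]] // ?;
  rewrite /=; ring.
Qed.

Lemma pairing_darboux_mx e w w' : (\row_i w i *m darboux_mx e *m (\row_i w' i)^T) 0 0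
  = e false * (w 0 * w' 2 - w 2 * w' 0) + e true * (w 1 * w' 3 - w 3 * w' 1).
Proof. rewrite mxE sum4 !mxE !sum4 !mxE /symp /=; ring. Qed.

(** On each pair the factor [l i] coming from the differential of [l i ^+ 2 / 2] is undone by the
    block [(l i)^-1]. *)
Lemma darboux_mx_pairs (l : bool -> K) w0 w1 : (forall i, l i != 0) ->
  on_pair false w0 -> on_pair true w1 ->
  darboux_mx (fun=> 1) *m (\row_j (w0 j + w1 j))^T
  = darboux_mx (fun i => (l i)^-1) *m (\row_j (l false * w0 j + l true * w1 j))^T.
Proof.
move=> l0 h0 h1; apply/matrixP => i j; rewrite !mxE; apply: eq_bigr => k _; rewrite !mxE.
have [E|/symp_parity ->] := eqVneq (odd i) (odd k); last by rewrite !mul0r.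
rewrite mulr1 -mulrA; congr (_ * _); rewrite E; case: (boolP (odd k)) => ok.
  by rewrite (h0 k) ?ok // mulr0 !add0r mulKf.
by rewrite (h1 k) ?(negPf ok) // mulr0 !addr0 mulKf.
Qed.

(** [X a i] models the bracket of the [a]-th coordinate with the coefficient of block [i]. If the
    indices meet both pairs, each term has a zero factor; inside one pair two indices coincide and
    antisymmetry cancels the sum. *)
Lemma jacobi_pairs (X : 'I_4 -> bool -> K) : (forall i (a : 'I_4), odd a != i -> X a i = 0) ->
  forall a b c : 'I_4, symp b c * X a (odd b) + symp c a * X b (odd c)
    + symp a b * X c (odd a) = 0.
Proof.
move=> hX a b c.
have [ab|ab] := eqVneq (odd a) (odd b); have [bc|bc] := eqVneq (odd b) (odd c).
- move: hX ab bc => _; rewrite /symp.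
  case: a => [[|[|[|[|]]]]] // pa; case: b => [[|[|[|[|]]]]] // pb;
  case: c => [[|[|[|[|]]]]] // pc //= _ _;
  rewrite ?(bool_irrelevance pa pb) ?(bool_irrelevance pb pc) ?(bool_irrelevance pa pc); ring.
- have ac : odd c != odd a by rewrite ab eq_sym.
  by rewrite (symp_parity bc) (symp_parity ac) (hX (odd a) c ac) !mul0r mulr0 !addr0.
- have ca : odd c != odd a by rewrite -bc eq_sym.
  by rewrite (symp_parity ab) (symp_parity ca) (hX (odd b) a ab) !mul0r mulr0 !addr0.
rewrite (symp_parity ab) (symp_parity bc) (hX (odd c) b bc) !mul0r mulr0 !addr0 //.
Qed.

Lemma darboux_mx_anti e : (darboux_mx e)^T = - darboux_mx e.
Proof.
apply/matrixP => i j; rewrite !mxE -mulNr.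
have [E|E] := eqVneq (odd i) (odd j); first by rewrite E /symp opprB.
by rewrite !symp_parity ?mulNr ?mul0r ?oppr0 // eq_sym.
Qed.

Lemma conj_anti (A N : 'M[K]_4) : N^T = - N -> (A *m N *m A^T)^T = - (A *m N *m A^T).
Proof. by move=> aN; rewrite !trmx_mul trmxK aN mulmxA mulmxN mulNmx. Qed.

Lemma pairing_delta_pair e w (i : 'I_4) j : odd i != j -> on_pair j w ->
  (\row_k (k == i)%:R *m darboux_mx e *m (\row_k w k)^T) 0 0 = 0.
Proof.
move=> ij hw; rewrite pairing_darboux_mx.
case: j ij hw => ij hw.
  rewrite (hw 0) // (hw 2) //.
  have -> : (1 == i) = false by apply: contraNF ij => /eqP <-.
  have -> : (3 == i) = false by apply: contraNF ij => /eqP <-.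
  rewrite /=; ring.
rewrite (hw 1) // (hw 3) //.
have -> : (0 == i) = false by apply: contraNF ij => /eqP <-.
have -> : (2 == i) = false by apply: contraNF ij => /eqP <-.
rewrite /=; ring.
Qed.

Lemma pairing_scale (N : 'M[K]_4) (s t : K) w w' :
  (\row_k w k *m N *m (\row_k (t * 0 + s * w' k))^T) 0 0
  = s * (\row_k w k *m N *m (\row_k w' k)^T) 0 0.
Proof.
have -> : \row_k (t * 0 + s * w' k) = s *: \row_k w' k :> 'rV[K]_4.
  by apply/rowP => k; rewrite !mxE mulr0 add0r.
by rewrite linearZ /= -scalemxAr mxE.
Qed.

Lemma half_sqr_rule (l m p q : K) :
  2^-1 * (2%:R * l ^+ 1 * p + 2%:R * m ^+ 1 * q) + (l ^+ 2 + m ^+ 2) * 0 = l * p + m * q.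
Proof. by rewrite !expr1; field. Qed.

End Darboux.

Section FrameDm.
Variable R : realType.
Local Notation C := R[i].
Implicit Types (f g : 'rV[R]_4 -> C) (x : 'rV[R]_4).

Lemma Pi_can_darboux x : Pi_can x = darboux_mx (fun=> 1) :> 'M[C]_4.
Proof. by apply/matrixP => i j; rewrite Pi_canE !mxE mulr1. Qed.

Lemma bracketC P f g x : (P x)^T = - P x -> bracket P f g x = - bracket P g f x.
Proof.
move=> aP; rewrite /bracket.
transitivity (((grad f x *m P x *m (grad g x)^T)^T) 0 0); first by rewrite [RHS]mxE.
by rewrite !trmx_mul trmxK aP mulmxA mulmxN mulNmx [LHS]mxE.
Qed.

Lemma bracketxx P f x : (P x)^T = - P x -> bracket P f f x = 0.
Proof.
move=> aP; apply/eqP; have /eqP := bracketC f f aP.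
by rewrite -addr_eq0 -mulr2n mulrn_eq0.
Qed.

Lemma frame_darboux P (fs : 'I_4 -> 'rV[R]_4 -> C) x (e : bool -> C) : (P x)^T = - P x ->
  bracket P (fs 0) (fs 1) x = 0 -> bracket P (fs 2) (fs 3) x = 0 ->
  bracket P (fs 0) (fs 2) x = e false -> bracket P (fs 0) (fs 3) x = 0 ->
  bracket P (fs 1) (fs 2) x = 0 -> bracket P (fs 1) (fs 3) x = e true ->
  frame fs x *m P x *m (frame fs x)^T = darboux_mx e.
Proof.
move=> aP h01 h23 h02 h03 h12 h13; rewrite frame_bracket; apply/matrixP => i j; rewrite !mxE.
have E (k : 'I_4) : [\/ k = 0, k = 1, k = 2 | k = 3].
  by case: k => [[|[|[|[|]]]]] // ?; [constructor 1|constructor 2|constructor 3|constructor 4];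
    exact: val_inj.
rewrite /symp; case: (E i) => ->; case: (E j) => ->;
  rewrite ?(bracketxx _ aP) ?h01 ?h23 ?h02 ?h03 ?h12 ?h13 /=
    ?(bracketC (fs 1) (fs 0) aP) ?(bracketC (fs 2) (fs 0) aP) ?(bracketC (fs 3) (fs 0) aP)
    ?(bracketC (fs 2) (fs 1) aP) ?(bracketC (fs 3) (fs 1) aP) ?(bracketC (fs 3) (fs 2) aP)
    ?h01 ?h23 ?h02 ?h03 ?h12 ?h13
    ?subrr ?mul0r ?oppr0 ?subr0 ?addr0 ?mul1r ?sub0r ?mulN1r //.
Qed.

Lemma bracket_near P f g g' x : {near x, g =1 g'} -> bracket P f g x = bracket P f g' x.
Proof. by move=> h; rewrite /bracket (grad_near h). Qed.

End FrameDm.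

Section SecondBracket.
Variable R : realType.
Local Notation C := R[i].
Implicit Types (f g : 'rV[R]_4 -> C) (x : 'rV[R]_4) (w : 'I_4 -> C).

Lemma smooth_mulmx (U : set 'rV[R]_4) m n p (M : 'rV[R]_4 -> 'M[C]_(m, n))
    (N : 'rV[R]_4 -> 'M[C]_(n, p)) : open U ->
  (forall i j, smooth_on U (fun x => M x i j)) ->
  (forall i j, smooth_on U (fun x => N x i j)) ->
  forall i j, smooth_on U (fun x => (M x *m N x) i j).
Proof.
move=> oU sM sN i j.
apply: (@smooth_eq _ _ (fun x => \sum_k M x i k * N x k j)) => //.
  by move=> x _; rewrite mxE.
by apply: smooth_sum => // k; exact: smooth_mul.
Qed.

Variables a b c : R.
Hypothesis c0 : c != 0.
Variables (U : set 'rV[R]_4) (uh : 'I_2 -> 'rV[R]_4 -> C).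
Hypothesis gb : generic_branches a b c U uh.
Let oU : open U := branches_open gb.

Definition darboux_coord (i : 'I_4) : 'rV[R]_4 -> C :=
  nth (fun=> 0) [:: uh 0; uh 1; phat uh 0; phat uh 1] i.
Definition pair_lam (i : bool) : 'rV[R]_4 -> C := lam a b c uh (if i then 1 else 0).

Let smooth_ucoord i : smooth_on U (@ucoord R i). Proof. exact: smooth_coord. Qed.

Let smooth_uh i : smooth_on U (uh i). Proof. by case: gb. Qed.

Lemma smooth_phat i : smooth_on U (phat uh i).
Proof.
have sB f g : smooth_on U f -> smooth_on U g -> smooth_on U (fun x => f x - g x).
  by move=> sf sg; apply: smooth_add => //; exact: smooth_opp.
have sd : smooth_on U (fun x => (ucoord 0 x - ucoord 1 x)^-1).
  apply: smooth_inv => //; last exact: sB.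
  by move=> x Ux; exact: ucoordB_neq0 (branches_regular gb Ux).
have sY : smooth_on U (ybranch uh i).
  by apply: smooth_inv => // x Ux; exact: (uh_neq0 c0 gb).
have sS : smooth_on U (@Sf R).
  apply: smooth_mul => //; apply: sB; apply: smooth_mul => //; exact: smooth_exp.
have sT : smooth_on U (@Tf R).
  apply: smooth_opp => //; apply: smooth_mul => //; apply: smooth_mul => //.
    exact: smooth_mul.
  by apply: sB; apply: smooth_mul => //; exact: smooth_exp.
apply: (@smooth_eq _ _ (fun x => - (ybranch uh i x ^+ 2 * (Sf x + Tf x * ybranch uh i x)))) => //.
  by move=> x Ux; rewrite (phatE c0 gb).
apply: smooth_opp => //; apply: smooth_mul => //; first exact: smooth_exp.
by apply: smooth_add => //; exact: smooth_mul.
Qed.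

Lemma smooth_lam i : smooth_on U (lam a b c uh i).
Proof.
have sV n : smooth_on U (fun x => (uh i x ^+ n)^-1).
  apply: smooth_inv => //; last exact: smooth_exp.
  by move=> x Ux; rewrite expf_neq0 // (uh_neq0 c0 gb).
have sk k : smooth_on U (fun=> k : C) by exact: smooth_cst.
apply: smooth_mul => //; apply: smooth_add => //; last exact: smooth_mul.
apply: smooth_add => //; last exact: smooth_mul.
apply: smooth_add => //; last exact: smooth_mul.
by apply: smooth_mul => //; apply: smooth_exp => //; exact: smooth_phat.
Qed.

Lemma smooth_darboux_coord i : smooth_on U (darboux_coord i).
Proof.
case: i => [[|[|[|[|]]]]] // ?.
- exact: smooth_uh.
- exact: smooth_uh.
- exact: smooth_phat.
- exact: smooth_phat.
Qed.

Lemma pair_lam_neq0 i x : U x -> pair_lam i x != 0.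
Proof. by move=> Ux; case: gb => _ _ _ _ h; case: i; exact: h. Qed.

Definition darboux_frame x : 'M[C]_4 := frame darboux_coord x.
(** The frame [M] satisfies [M J M^T = J] with [J^2 = -1], hence [M^-1 = - J M^T J]. Being explicit,
    this inverse visibly has smooth entries. *)
Definition darboux_frame_inv x : 'M[C]_4 := - (darboux_mx (fun=> 1) *m (darboux_frame x)^T *m darboux_mx (fun=> 1)).
Definition second_Pi x : 'M[C]_4 := darboux_frame_inv x *m darboux_mx (fun i => (pair_lam i x)^-1) *m (darboux_frame_inv x)^T.

Let c01 : [/\ darboux_coord 0 = uh 0, darboux_coord 1 = uh 1, darboux_coord 2 = phat uh 0 & darboux_coord 3 = phat uh 1].
Proof. by []. Qed.

Lemma darboux_frame_canonical x : U x -> darboux_frame x *m Pi_can x *m (darboux_frame x)^T = darboux_mx (fun=> 1).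
Proof.
move=> Ux; have [q0 q1 p0 p1] := c01.
apply: frame_darboux; rewrite ?q0 ?q1 ?p0 ?p1.
- apply/matrixP => i j; rewrite mxE [RHS]mxE !Pi_canE; exact: (esym (opprB _ _)).
- exact: (canonical_qq c0 gb Ux).
- exact: (canonical_pp c0 gb Ux).
- exact: (canonical_q0p0 c0 gb Ux).
- exact: (canonical_q0p1 c0 gb Ux).
- exact: (canonical_q1p0 c0 gb Ux).
- exact: (canonical_q1p1 c0 gb Ux).
Qed.

Lemma darboux_frameK x : U x -> darboux_frame x *m darboux_frame_inv x = 1%:M.
Proof.
move=> Ux; have := darboux_frame_canonical Ux; rewrite Pi_can_darboux /darboux_frame_inv => h.
by rewrite mulmxN !mulmxA h darboux_mx1_sqr opprK.
Qed.

Lemma darboux_frame_invK x : U x -> darboux_frame_inv x *m darboux_frame x = 1%:M.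
Proof. by move/darboux_frameK/mulmx1C. Qed.

Lemma darboux_frame_unit x : U x -> darboux_frame x \in unitmx.
Proof. by move/darboux_frameK/mulmx1_unit => []. Qed.

Lemma second_bivector_darboux P' : second_bivector a b c U uh P' ->
  forall x, U x -> darboux_frame x *m P' x *m (darboux_frame x)^T = darboux_mx (fun i => (pair_lam i x)^-1).
Proof.
move=> sb x Ux; have [aP h h01 h23] := sb x Ux; have [q0 q1 p0 p1] := c01.
have h00 := h 0 0; have h0' := h 0 1; have h10 := h 1 0; have h11 := h 1 1.
apply: frame_darboux; rewrite ?q0 ?q1 ?p0 ?p1.
- exact: aP.
- exact: h01.
- exact: h23.
- by rewrite h00 eqxx mulr1n.
- exact: h0'.
- exact: h10.
- by rewrite h11 eqxx mulr1n.
Qed.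

(** The prescribed brackets fix the bivector in an invertible frame, so every property can be proved
    on the explicit [second_Pi]. *)
Lemma second_bivectorE P' : second_bivector a b c U uh P' ->
  forall x, U x -> P' x = second_Pi x.
Proof.
move=> sb x Ux; rewrite /second_Pi -(second_bivector_darboux sb Ux).
by rewrite !mulmxA (darboux_frame_invK Ux) mul1mx -mulmxA -trmx_mul (darboux_frame_invK Ux) trmx1 mulmx1.
Qed.

Lemma second_Pi_darboux x : U x -> darboux_frame x *m second_Pi x *m (darboux_frame x)^T = darboux_mx (fun i => (pair_lam i x)^-1).
Proof.
by move=> Ux; rewrite /second_Pi !mulmxA (darboux_frameK Ux) mul1mx -mulmxA -trmx_mul (darboux_frameK Ux) trmx1 mulmx1.
Qed.

Lemma second_Pi_anti x : (second_Pi x)^T = - second_Pi x.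
Proof.
exact: conj_anti (darboux_mx_anti _).
Qed.

Lemma second_Pi_second_bivector : second_bivector a b c U uh second_Pi.
Proof.
move=> x Ux; have [q0 q1 p0 p1] := c01.
have E i j : bracket second_Pi (darboux_coord i) (darboux_coord j) x = symp C i j * (pair_lam (odd i) x)^-1.
  have := second_Pi_darboux Ux; rewrite frame_bracket => /matrixP/(_ i j).
  by rewrite mxE [RHS]mxE.
have := E 0 1; have := E 2 3; have := E 0 2; have := E 0 3; have := E 1 2; have := E 1 3.
rewrite q0 q1 p0 p1 /symp /= !(subr0, mul0r, mul1r) => e13 e12 e03 e02 e23 e01.
split; [exact: second_Pi_anti | move=> i j | exact: e01 | exact: e23].
have I2 (k : 'I_2) : k = 0 \/ k = 1.
  by case: k => [[|[|]]] // ?; [left|right]; exact: val_inj.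
by case: (I2 i) => ->; case: (I2 j) => ->; [exact: e02|exact: e03|exact: e12|exact: e13].
Qed.


Lemma dframe_darboux_coord i x : U x -> dframe (darboux_frame x) (darboux_coord i) x (fun j => (j == i)%:R).
Proof. by move=> Ux; apply: dframe_frame; exact: smooth_differentiable (smooth_darboux_coord i) Ux. Qed.

(** Separation of variables: [lambda_i] is a function of [uhat_i] and [phat_i] only. *)
Lemma dframe_pair_lam i x : U x ->
  exists2 w, on_pair i w & dframe (darboux_frame x) (pair_lam i) x w.
Proof.
move=> Ux; pose qi : 'I_4 := if i then 1 else 0; pose pi : 'I_4 := if i then 3 else 2.
have [q0 q1 p0 p1] := c01.
have Dq : dframe (darboux_frame x) (uh (if i then 1 else 0)) x (fun j => (j == qi)%:R).
  by rewrite /qi; case: (i); [rewrite -q1|rewrite -q0]; exact: dframe_darboux_coord.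
have Dp : dframe (darboux_frame x) (phat uh (if i then 1 else 0)) x (fun j => (j == pi)%:R).
  by rewrite /pi; case: (i); [rewrite -p1|rewrite -p0]; exact: dframe_darboux_coord.
have nz n : uh (if i then 1 else 0) x ^+ n != 0 by rewrite expf_neq0 // (uh_neq0 c0 gb).
pose k (z : C) := dframe_cst (darboux_frame x) z x.
have H := dframe_mul (dframe_add (dframe_add (dframe_add
  (dframe_mul (dframe_exp 4 Dq) (dframe_exp 2 Dp))
  (dframe_mul (k a%:C) (dframe_inv (nz 2%N) (dframe_exp 2 Dq))))
  (dframe_mul (k b%:C) (dframe_inv (nz 3%N) (dframe_exp 3 Dq))))
  (dframe_mul (k c%:C) (dframe_inv (nz 4%N) (dframe_exp 4 Dq)))) (k 2^-1).
(* The witness is the coefficient family computed in [H]; off the pair, every summand has a zero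
   factor. *)
refine (ex_intro2 _ _ _ _ H) => j ji.
have -> : (j == qi) = false by apply: contraNF ji => /eqP ->; rewrite /qi; case: (i).
have -> : (j == pi) = false by apply: contraNF ji => /eqP ->; rewrite /pi; case: (i).
by rewrite !mulr0n !mulr0 !addr0 !mulr0.
Qed.

Lemma ham_fieldE P f x w : dframe (darboux_frame x) f x w ->
  darboux_frame x *m ham_field P f x = darboux_frame x *m P x *m (darboux_frame x)^T *m (\row_j w j)^T.
Proof. by move=> [_ gf]; rewrite /ham_field gf trmx_mul !mulmxA. Qed.

Lemma ham_field_bihamiltonian x : U x ->
  ham_field (@Pi_can R) (fun y => pair_lam false y + pair_lam true y) x
  = ham_field second_Pi (fun y => (pair_lam false y ^+ 2 + pair_lam true y ^+ 2) / 2) x.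
Proof.
move=> Ux; have [w0 h0 D0] := dframe_pair_lam false Ux; have [w1 h1 D1] := dframe_pair_lam true Ux.
apply: (can_inj (mulKmx (darboux_frame_unit Ux))).
rewrite (ham_fieldE _ (dframe_add D0 D1)).
have H := dframe_mul (dframe_add (dframe_exp 2 D0) (dframe_exp 2 D1)) (dframe_cst (darboux_frame x) 2^-1 x).
have H' : dframe (darboux_frame x) (fun y => (pair_lam false y ^+ 2 + pair_lam true y ^+ 2) / 2) x
    (fun j => pair_lam false x * w0 j + pair_lam true x * w1 j).
  by apply: dframe_eq H => j; exact: half_sqr_rule.
rewrite (ham_fieldE _ H') (darboux_frame_canonical Ux) (second_Pi_darboux Ux).
exact: (darboux_mx_pairs (fun i => pair_lam_neq0 i Ux) h0 h1).
Qed.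

(** Both Hamiltonians are functions of the two [lambda_i], whose differentials lie on different
    pairs; within each pair the two differentials are proportional and pair to zero. *)
Lemma Hhat_involution2 x : U x -> bracket second_Pi (Hhat1 a b c) (Hhat2 a b c) x = 0.
Proof.
move=> Ux; have [w0 h0 D0] := dframe_pair_lam false Ux; have [w1 h1 D1] := dframe_pair_lam true Ux.
pose k (z : C) := dframe_cst (darboux_frame x) z x.
have D2 := dframe_mul (k 2) (dframe_add D0 D1).
have D3 := dframe_opp (dframe_exp 2 (dframe_add D0 (dframe_opp D1))).
have n1 : {near x, (fun y => 2 * (pair_lam false y + pair_lam true y)) =1 Hhat1 a b c}.
  by apply: filterS (branches_near gb Ux) => y Uy; have [-> _] := Hhat_lam c0 gb Uy.
have n2 : {near x, (fun y => - (pair_lam false y - pair_lam true y) ^+ 2) =1 Hhat2 a b c}.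
  by apply: filterS (branches_near gb Ux) => y Uy; have [_ ->] := Hhat_lam c0 gb Uy.
have E1 := dframe_near n1 D2; have E2 := dframe_near n2 D3.
rewrite (bracket_dframe _ E1 E2) (second_Pi_darboux Ux) pairing_darboux_mx.
rewrite (h0 1) // (h0 3) // (h1 0) // (h1 2) //.
move: (pair_lam false x) (pair_lam true x) (w0 0) (w0 2) (w1 1) (w1 3) => l m p q r s; ring.
Qed.

(** In the frame the pencil is [darboux_mx] with blocks [e i = s + t / lambda_i]. Brackets of
    coordinates are then constants times some [e i], so iterated brackets only involve brackets of
    coordinates with the [e i], as in [jacobi_pairs]. *)
Lemma pencil_compatible : compatible_on U (@Pi_can R) second_Pi.
Proof.
move=> s t; pose Q x := s *: Pi_can x + t *: second_Pi x.
have sDm (e : bool -> 'rV[R]_4 -> C) : (forall i, smooth_on U (e i)) ->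
    forall i j, smooth_on U (fun x => darboux_mx (fun i => e i x) i j).
  move=> se i j; apply: (@smooth_eq _ _ (fun x => symp C i j * e (odd i) x)) => //.
    by move=> x _; rewrite mxE.
  by apply: smooth_mul => //; exact: smooth_cst.
have s1 i j : smooth_on U (fun x => darboux_mx (fun=> 1 : C) i j) by exact: smooth_cst.
have sM i j : smooth_on U (fun x => darboux_frame x i j).
  apply: (@smooth_eq _ _ (pd j (darboux_coord i))) => //; first by move=> x _; rewrite 2!mxE.
  by apply: smooth_pd; exact: smooth_darboux_coord.
have str n m (A : 'rV[R]_4 -> 'M[C]_(n, m)) : (forall i j, smooth_on U (fun x => A x i j)) ->
    forall i j, smooth_on U (fun x => (A x)^T i j).
  by move=> sA i j; apply: (@smooth_eq _ _ (fun x => A x j i)) => // x _; rewrite mxE.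
have sMi i j : smooth_on U (fun x => darboux_frame_inv x i j).
  apply: (@smooth_eq _ _ (fun x => - (darboux_mx (fun=> 1) *m (darboux_frame x)^T *m darboux_mx (fun=> 1)) i j)) => //.
    by move=> x _; rewrite [RHS]mxE.
  apply: smooth_opp => //; apply: smooth_mulmx => //; apply: smooth_mulmx => //.
  exact: str.
have sP2 i j : smooth_on U (fun x => second_Pi x i j).
  apply: smooth_mulmx => //; last exact: str.
  apply: smooth_mulmx => //; apply: sDm => k.
  by apply: smooth_inv => //; [exact: pair_lam_neq0|exact: smooth_lam].
have sQ i j : smooth_on U (fun x => Q x i j).
  apply: (@smooth_eq _ _ (fun x => s * darboux_mx (fun=> 1) i j + t * second_Pi x i j)) => //.
    by move=> x _; rewrite /Q Pi_can_darboux [RHS]mxE [X in _ = X + _]mxE [X in _ = _ + X]mxE.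
  by apply: smooth_add => //; apply: smooth_mul => //; exact: smooth_cst.
have aQ x : U x -> (Q x)^T = - Q x.
  move=> _; rewrite /Q linearD /= !linearZ /= second_Pi_anti Pi_can_darboux darboux_mx_anti.
  by rewrite !scalerN opprD.
split=> // x Ux.
apply: (jacobi_frame oU smooth_darboux_coord sQ aQ Ux (darboux_frame_unit Ux)).
pose e (i : bool) y := s * 1 + t * (pair_lam i y)^-1.
have QE y : U y -> darboux_frame y *m Q y *m (darboux_frame y)^T = darboux_mx (fun i => e i y).
  move=> Uy; rewrite /Q mulmxDr mulmxDl -!scalemxAr -!scalemxAl.
  by rewrite (darboux_frame_canonical Uy) (second_Pi_darboux Uy) darboux_mx_comb.
have bQ i j y : U y ->
    bracket Q (darboux_coord i) (darboux_coord j) y = symp C i j * e (odd i) y.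
  by move/QE; rewrite frame_bracket => /matrixP/(_ i j); rewrite mxE [RHS]mxE.
have eX i : exists2 w, on_pair i w & dframe (darboux_frame x) (e i) x w.
  have [w hw Dw] := dframe_pair_lam i Ux.
  have H := dframe_add (dframe_cst (darboux_frame x) (s * 1) x)
    (dframe_mul (dframe_cst (darboux_frame x) t x) (dframe_inv (pair_lam_neq0 i Ux) Dw)).
  refine (ex_intro2 _ _ _ _ H) => k ki.
  by rewrite (hw k ki) !mulr0 !addr0.
pose X (i : 'I_4) (j : bool) := bracket Q (darboux_coord i) (e j) x.
have X0 j (i : 'I_4) : odd i != j -> X i j = 0.
  move=> ij; have [w hw Dw] := eX j.
  rewrite /X (bracket_dframe _ (dframe_darboux_coord i Ux) Dw) (QE x Ux).
  exact: pairing_delta_pair ij hw.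
have XE i j k : bracket Q (darboux_coord i) (fun y => bracket Q (darboux_coord j) (darboux_coord k) y) x
    = symp C j k * X i (odd j).
  rewrite (@bracket_near _ Q _ _ (fun y => symp C j k * e (odd j) y)); last first.
    by apply: filterS (branches_near gb Ux) => y; exact: bQ.
  have [w _ Dw] := eX (odd j).
  by rewrite (bracket_dframe _ (dframe_darboux_coord i Ux) (dframe_mul (dframe_cst _ _ _) Dw))
    /X (bracket_dframe _ (dframe_darboux_coord i Ux) Dw) pairing_scale.
move=> i j k; rewrite (XE i j k) (XE j k i) (XE k i j).
exact: jacobi_pairs X0 i j k.
Qed.

End SecondBracket.

Lemma poisson_on_eq (R : realType) (U : set 'rV[R]_4) (P Q : 'rV[R]_4 -> 'M[R[i]]_4) :
  open U -> (forall x, U x -> P x = Q x) -> poisson_on U P -> poisson_on U Q.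
Proof.
move=> oU PQ [sP aP jP]; split=> [i j|x Ux|x Ux i j k].
- by apply: smooth_eq (sP i j) => // x Ux; rewrite PQ.
- by rewrite -(PQ x Ux); exact: aP.
rewrite -[RHS](jP x Ux i j k); apply: eq_bigr => l _.
have E m n : pd l (fun y => Q y m n) x = pd l (fun y => P y m n) x.
  by apply: pd_near; apply: filterS (open_nbhs_nbhs (conj oU Ux)) => y /PQ ->.
by rewrite !E (PQ x Ux).
Qed.

Theorem mainTheorem4 (R : realType) (a b c : R) (hc : c != 0) :
  [/\ integrable_on (@regular_points R) (Hhat1 a b c) (Hhat2 a b c),
      forall u1 u2 : R, u1 != 0 -> u2 != 0 -> u1 != u2 ->
        exists q : mpoly.mpoly 2 R,
          total_degree q = 6%N
          /\ forall p : 'I_2 -> R,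
               H2 a b c u1 u2 (p 0) (p 1) = mpoly.meval p q
    & forall (U : set 'rV[R]_4) (uh : 'I_2 -> 'rV[R]_4 -> R[i]),
        generic_branches a b c U uh ->
        let l1 := lam a b c uh 0 in
        let l2 := lam a b c uh 1 in
        [/\ forall x, U x -> Hhat1 a b c x = 2 * (l1 x + l2 x),
            forall x, U x -> Hhat2 a b c x = - (l1 x - l2 x) ^+ 2,
            exists P', second_bivector a b c U uh P'
          & forall P', second_bivector a b c U uh P' ->
              [/\ compatible_on U (@Pi_can R) P',
                  forall x, U x ->
                    bracket P' (Hhat1 a b c) (Hhat2 a b c) x = 0
                & forall x, U x ->
                    ham_field (@Pi_can R) (fun y => l1 y + l2 y) x
                    = ham_field P'
                        (fun y => (l1 y ^+ 2 + l2 y ^+ 2) / 2) x]]].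
Proof.
split; first exact: Hhat_integrable.
  by move=> u1 u2 u10 u20 u12; exact: H2_polynomial.
move=> U uh gb l1 l2; split=> [x Ux|x Ux||P' sb].
- by have [] := Hhat_lam hc gb Ux.
- by have [] := Hhat_lam hc gb Ux.
- by exists (second_Pi a b c uh); exact: (second_Pi_second_bivector hc gb).
have PE := second_bivectorE hc gb sb.
split=> [s t|x Ux|x Ux].
- apply: (poisson_on_eq (branches_open gb) _ (pencil_compatible hc gb s t)) => x Ux.
  by rewrite (PE x Ux).
- by rewrite /bracket (PE x Ux); exact: (Hhat_involution2 hc gb Ux).
by rewrite [in RHS]/ham_field (PE x Ux); exact: (ham_field_bihamiltonian hc gb Ux).
Qed.
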